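(* Let $(X,d)$ be a dendrite and let $f:X\to X$ be a continuous monotone map. For each $n\in\mathbb N$: (a) $\omega_{\mathcal T_n(f)}(T)$ is a minimal set of $\mathcal T_n(f)$ for each $T\in\mathcal T_n(X)$; (b) $\overline{\mathrm P(\mathcal T_n(f))}=\Lambda(\mathcal T_n(f))=\mathrm{RR}(\mathcal T_n(f))$.
   Context: A dendrite is a locally connected continuum (compact connected metric space) containing no simple closed curve. A map is monotone if the preimage of every connected set is connected. $\mathbb N$ denotes the positive integers. An endpoint of a dendrite $Y$ is a point $p$ such that $Y\setminus\{p\}$ is connected and nonempty; a tree is a dendrite with finitely many endpoints; by convention a one-point set is a tree whose only point is its unique endpoint. $2^X$ is the set of nonempty closed subsets of $X$ with the Hausdorff metric $d_H$, and $2^f:2^X\to 2^X$, $2^f(A)=f(A)$. $\mathcal T_n(X)\subset 2^X$ is the family of trees contained in $X$ with at most $n$ endpoints; it is a closed subset of $2^X$, mapped into itself by $2^f$ when $f$ is monotone, and $\mathcal T_n(f)=2^f|_{\mathcal T_n(X)}:\mathcal T_n(X)\to\mathcal T_n(X)$. For a continuous self-map $F$ of a compact metric space $(Y,\rho)$: $\omega_F(y)=\bigcap_{n\in\mathbb N}\overline{\{F^k(y):k\ge n\}}$; $\Lambda(F)=\bigcup_{y\in Y}\omega_F(y)$; $\mathrm P(F)$ is the set of periodic points; $\mathrm{RR}(F)$ is the set of regularly recurrent points, i.e. $y$ such that for every $\varepsilon>0$ there is $N\in\mathbb N$ with $\rho(y,F^{kN}(y))<\varepsilon$ for all $k\in\mathbb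 N$. A minimal set of $F$ is a nonempty closed $F$-invariant set ($F(M)\subset M$) that is minimal with respect to inclusion for these properties. *)

(* Defs.v *)
From HB Require Import structures.
From mathcomp Require Import all_boot all_order all_algebra.
From mathcomp Require Import all_classical all_reals.
From mathcomp Require Import topology normedtype.

Set Implicit Arguments.
Unset Strict Implicit.
Unset Printing Implicit Defensive.

Import Order.TTheory GRing.Theory Num.Theory.
Import numFieldNormedType.Exports.

Local Open Scope classical_set_scope.
Local Open Scope ring_scope.

Section Dendrites.
Context {R : realType} {X : metricType R}.
Implicit Types (A S T : set X) (p : X) (f : X -> X).

(* All notions are for subsets of X with the subspace topology: the relatively
   open subsets of A are the sets A `&` V with V open. *)
Definition continuum A := [/\ A !=set0, compact A & connected A].

Definition locally_connected A :=
  forall x U, A x -> open U -> U x ->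
    exists V, [/\ open V, V x, connected (A `&` V) & A `&` V `<=` U].

Definition homeomorphic (T1 T2 : topologicalType) (A : set T1) (B : set T2) :=
  exists (g : T1 -> T2) (h : T2 -> T1),
    [/\ {within A, continuous g} /\ {within B, continuous h},
        {homo g : x / A x >-> B x} /\ {homo h : y / B y >-> A y},
        (forall x, A x -> h (g x) = x) & (forall y, B y -> g (h y) = y)].

Definition unit_circle : set (R * R) :=
  [set z | z.1 ^+ 2 + z.2 ^+ 2 = 1].

Definition simple_closed_curve S := homeomorphic unit_circle S.

Definition dendrite A :=
  [/\ continuum A, locally_connected A &
      ~ exists2 S, simple_closed_curve S & S `<=` A].

Definition endpoint A : set X :=
  [set p | A p /\
     (A = [set p] \/ (A `\ p !=set0 /\ connected (A `\ p)))].

Definition tree A := dendrite A /\ finite_set (endpoint A).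

Definition monotone_map f := forall C : set X, connected C -> connected (f @^-1` C).

Lemma dendrite_compact A : dendrite A -> compact A.
Proof. by case=> -[]. Qed.

End Dendrites.

Section Hyperspace.
Context {R : realType} {X : metricType R}.

(* The proof that X is compact is a parameter of the type because the Hausdorff
   metric on closed sets is only finite when X is bounded. *)
Record hyperspace (cX : compact [set: X]) := Hyperspace {
  hset :> set X;
  hset_closed : closed hset;
  hset_neq0 : hset !=set0 }.
Arguments hset_closed {cX} h : rename.
Arguments hset_neq0 {cX} h : rename.

Variable cX : compact [set: X].
Implicit Types A B C : hyperspace cX.

HB.instance Definition _ := gen_eqMixin (hyperspace cX).
HB.instance Definition _ := gen_choiceMixin (hyperspace cX).

Lemma hset_inj A B : hset A = hset B -> A = B.
Proof.
case: A B => [A cA A0] [B cB B0] /= AB; subst B.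
by rewrite (Prop_irrelevance cA cB) (Prop_irrelevance A0 B0).
Qed.

(* The epsilon-neighborhood of B contains A. *)
Definition in_thickening (e : R) (A B : set X) :=
  forall a, A a -> exists2 b, B b & mdist a b < e.

Definition hausdorff_radii A B : set R :=
  [set e | [/\ 0 < e, in_thickening e A B & in_thickening e B A]].

Definition hausdorff_dist A B : R := inf (hausdorff_radii A B).

Lemma compact_mdist_bounded : exists2 M : R, 0 < M & forall x y : X, mdist x y < M.
Proof.
have [[x0 _]|X0] := pselect ([set: X] !=set0); last first.
  by exists 1 => // x; exfalso; apply: X0; exists x.
have /compact_near_coveringP cn := cX.
pose P (M : R) (y : X) := mdist x0 y < M.
have : \forall M \near +oo, [set: X] `<=` P M.
  apply: cn => x _.
  exists (ball x 1, [set M | mdist x0 x + 1 < M]) => /=.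
    split; first exact: nbhsx_ballx.
    exact: nbhs_pinfty_gt (num_real _).
  move=> [y M] /= []; rewrite ballEmdist /= => xy /(lt_trans _); apply.
  by apply: (le_lt_trans (metric_triangle x0 x y)); rewrite ltrD2l.
move=> [M [_ MP]].
have {}MP y : mdist x0 y < M + 1 by apply: MP; rewrite ?ltrDl.
exists (M + 1 + (M + 1)).
  by rewrite addr_gt0 // (le_lt_trans _ (MP x0)) ?mdist_ge0.
move=> x y; apply: (le_lt_trans (metric_triangle x x0 y)).
by rewrite ltrD // metric_sym.
Qed.

Lemma hausdorff_radii_neq0 A B : hausdorff_radii A B !=set0.
Proof.
have [M M0 MP] := compact_mdist_bounded.
exists M; split=> // [a _|b _].
  by have [b Bb] := hset_neq0 B; exists b.
by have [a Aa] := hset_neq0 A; exists a.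
Qed.

Lemma hausdorff_radii_inf A B : has_inf (hausdorff_radii A B).
Proof.
split; first exact: hausdorff_radii_neq0.
by exists 0 => e [/ltW].
Qed.

Lemma hausdorff_radii_lt A B e : hausdorff_dist A B < e -> hausdorff_radii A B e.
Proof.
move=> /(inf_lt (hausdorff_radii_neq0 A B))[d [d0 AB BA] de].
split; first exact: lt_trans de.
- by move=> a /AB[b Bb abd]; exists b => //; exact: lt_trans de.
- by move=> b /BA[a Aa abd]; exists a => //; exact: lt_trans de.
Qed.

Lemma hausdorff_dist_le A B e : hausdorff_radii A B e -> hausdorff_dist A B <= e.
Proof. by move=> ABe; apply: ge_inf => //; case: (hausdorff_radii_inf A B). Qed.

Lemma hausdorff_dist_ge0 A B : 0 <= hausdorff_dist A B.
Proof.
by apply: lb_le_inf; [exact: hausdorff_radii_neq0|move=> e [/ltW]].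
Qed.

Lemma hausdorff_distxx A : hausdorff_dist A A = 0.
Proof.
apply/eqP; rewrite eq_le hausdorff_dist_ge0 andbT.
apply/ler_addgt0Pl => e e0; rewrite addr0.
by apply: hausdorff_dist_le; split=> // a Aa; exists a => //; rewrite mdistxx.
Qed.

Lemma hausdorff_dist_sym A B : hausdorff_dist A B = hausdorff_dist B A.
Proof.
by congr inf; apply/seteqP; split=> e [e0 ? ?].
Qed.

Lemma hausdorff_dist_triangle B A C :
  hausdorff_dist A C <= hausdorff_dist A B + hausdorff_dist B C.
Proof.
apply/ler_addgt0Pr => e e0.
have e20 : 0 < e / 2 by rewrite divr_gt0.
have /hausdorff_radii_lt[r0 AB BA] :
  hausdorff_dist A B < hausdorff_dist A B + e / 2 by rewrite ltrDl.
have /hausdorff_radii_lt[s0 BC CB] :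
  hausdorff_dist B C < hausdorff_dist B C + e / 2 by rewrite ltrDl.
rewrite [e in leRHS]splitr addrACA; apply: hausdorff_dist_le.
split; first exact: addr_gt0.
- move=> a /AB[b /BC[c Cc bc] ab]; exists c => //.
  by apply: (le_lt_trans (metric_triangle a b c)); rewrite ltrD.
- move=> c /CB[b /BA[a Aa ba] cb]; exists a => //.
  by apply: (le_lt_trans (metric_triangle c b a)); rewrite addrC ltrD.
Qed.

Lemma hausdorff_dist_positivity A B : hausdorff_dist A B = 0 -> A = B.
Proof.
have sub C D : hausdorff_dist C D = 0 -> C `<=` D.
  move=> CD0 x Cx; apply: (hset_closed D) => U /nbhs_ballP[e /= e0 xeU].
  have /hausdorff_radii_lt[_ /(_ _ Cx)[y Dy xy] _] : hausdorff_dist C D < e.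
    by rewrite CD0.
  by exists y; split=> //; apply: xeU; rewrite ballEmdist.
move=> AB0; apply: hset_inj; apply/seteqP; split; apply: sub => //.
by rewrite hausdorff_dist_sym.
Qed.

HB.instance Definition _ := isMetric.Build R (hyperspace cX)
  hausdorff_distxx hausdorff_dist_positivity hausdorff_dist_sym
  hausdorff_dist_triangle.

Section HyperspaceMap.
Variables (f : X -> X) (cf : continuous f).

Lemma image_closed A : closed (f @` A).
Proof.
apply: compact_closed; first exact: metric_hausdorff.
apply: continuous_compact; first exact: continuous_subspaceT.
exact: subclosed_compact (hset_closed A) cX (@subsetT _ _).
Qed.

Lemma image_neq0 A : f @` A !=set0.
Proof. by have [a Aa] := hset_neq0 A; exists (f a), a. Qed.

Definition hyperspace_map A : hyperspace cX :=
  Hyperspace cX (@image_closed A) (image_neq0 A).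

End HyperspaceMap.

Definition trees (n : nat) : set (hyperspace cX) :=
  [set T : hyperspace cX | tree T /\ (endpoint T #<= `I_n)%card].

End Hyperspace.

(* Dynamics of the restriction F|Y : Y -> Y, where Y is a subset of Z, with the
   metric of Z, that F maps into itself.  Closures and closed sets are relative
   to the subspace Y. *)
Section RestrictedDynamics.
Context {R : realType} {Z : metricType R}.
Variables (Y : set Z) (F : Z -> Z).
Implicit Types (M : set Z) (y : Z).

Definition closure_in M : set Z := Y `&` closure M.

Definition closed_in M := exists2 C, closed C & M = Y `&` C.

Definition omega_limit y : set Z :=
  \bigcap_(n in [set n | (0 < n)%N])
    closure_in [set iter k F y | k in [set k | (n <= k)%N]].

Definition Lambda : set Z := \bigcup_(y in Y) omega_limit y.

Definition periodic_points : set Z :=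
  [set y | Y y /\ exists2 m, (0 < m)%N & iter m F y = y].

Definition regularly_recurrent : set Z :=
  [set y | Y y /\ forall e : R, 0 < e ->
     exists2 N, (0 < N)%N &
       forall k, (0 < k)%N -> mdist y (iter (k * N) F y) < e].

Definition closed_invariant M := [/\ M !=set0, closed_in M & F @` M `<=` M].

Definition minimal_set M :=
  closed_invariant M /\
  forall M', closed_invariant M' -> M' `<=` M -> M' = M.

End RestrictedDynamics.

(* Main.v *)
Require Import Defs.
From mathcomp Require Import all_boot all_order all_algebra.
From mathcomp Require Import all_classical all_reals.
From mathcomp Require Import topology normedtype.
From mathcomp Require Import zify ring lra.

(** For points [a], [b] of the dendrite [X], let [seg a b] be the intersection of
    all connected sets containing both; since [X] is arcwise connected and
    contains no circle, it is the unique arc from [a] to [b]. Fix a root [p] with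
    [f p = p] and put [x <= y] when [x] lies on [seg p y]: a tree order with
    meets, which the monotone map [f] preserves.

    Let [x_l] be an orbit of [f]. Either [x] is asymptotic to a periodic orbit,
    or the meet of [x_l] and [x_(l+d)] is below [x_(l+kd)] for all [k]. In the
    second case the times [l] with [t <= x_l] eventually form an arithmetic
    progression, for every [t]. By compactness, in both cases, for every [e > 0]
    there are [N] and [M] with [d(x_m, x_(m+kN)) < e] for all [m >= M] and [k].

    A tree with at most [n] endpoints is the hull of [n] points, and the hull
    depends continuously on them and commutes with [f]. Hence the orbits of
    [T_n(f)] have the same uniform recurrence property, which makes the omega-limit
    sets minimal and their points regularly recurrent. As to periodic points: if
    all [f^(kN) c] are close to [c], then [f^N] maps a small subdendrite around [c]
    into itself and has a fixed point there; conversely a limit [y] of periodic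
    points of [f] is recurrent, because [f^(n!) y] tends to [y]. *)

Set Implicit Arguments.
Unset Strict Implicit.
Unset Printing Implicit Defensive.

Import Order.TTheory GRing.Theory Num.Theory.
Import numFieldNormedType.Exports.

Local Open Scope classical_set_scope.
Local Open Scope ring_scope.

(** * Connectedness in metric spaces *)

Section Connectedness.
Context {T : topologicalType}.
Implicit Types A B C : set T.

(** Defining [seg] through connected sets reduces statements about meets, monotone maps and hulls to
    inclusions between connected sets. Parametrized arcs serve to show that [seg a b] is closed and
    connected. They must still be built: the hypothesis only excludes homeomorphic images of the
    circle, so local connectedness has to yield injective paths. Chains are refined to a path, its
    loops are erased, and the result is reparametrized.

    The root exists because a maximal [z] with [z <= f z] is fixed. The dichotomy for orbits comes
    from the meet [w] of [z] and [g z], where [g] is the [d]-th iterate of [f]: if [w <= g w], then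
    [w] stays below every [g]-iterate of [z]; otherwise the successive meets descend to a fixed
    point of [g], and the orbit converges to it.

    Two distinct points are separated by some threshold [t]. Compactness leaves finitely many
    thresholds to consider, and a factorial is a common multiple of their periods. The resulting [N]
    serves all late [m] and all [k] at once, which is what survives the passage to limits. *)

Lemma connected_meet_open C A B a b : connected C -> open A -> open B ->
  C `<=` A `|` B -> C a -> A a -> C b -> B b -> exists x, [/\ C x, A x & B x].
Proof.
move=> cC oA oB CAB Ca Aa Cb Bb; apply: contrapT => nex.
have E : C `&` A = C `&` ~` B.
  apply/seteqP; split=> x [Cx].
    by move=> Ax; split=> // Bx; apply: nex; exists x.
  by move=> nBx; split=> //; case: (CAB _ Cx).
have CA : C `&` A = C.
  apply: cC; first by exists a.
  - by exists A.
  - by exists (~` B) => //; exact: open_closedC.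
by move: Cb; rewrite -CA E => -[_]; apply.
Qed.

Lemma connected_meet_closed C A B a b : connected C -> closed A -> closed B ->
  C `<=` A `|` B -> C a -> A a -> C b -> B b -> exists x, [/\ C x, A x & B x].
Proof.
move=> cC oA oB CAB Ca Aa Cb Bb; apply: contrapT => nex.
have [] := @connected_meet_open C (~` A) (~` B) b a cC _ _ _ Cb _ Ca _.
- exact: closed_openC.
- exact: closed_openC.
- move=> x Cx; have [Ax|Bx] := CAB _ Cx.
    by right=> Bx; apply: nex; exists x.
  by left=> Ax; apply: nex; exists x.
- by move=> Ab; apply: nex; exists b.
- by move=> Ba; apply: nex; exists a.
- by move=> x [Cx nA nB]; case: (CAB _ Cx).
Qed.

Lemma connected_between A B : connected A -> A `<=` B -> B `<=` closure A ->
  connected B.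
Proof.
move=> cA AB BA U [u Uu] [C1 oC1 C1E] [C2 cC2 C2E].
have AU : A `<=` C2.
  have : A `&` C1 !=set0.
    move: Uu; rewrite C1E => -[Bu C1u].
    by apply: (BA _ Bu); exact: open_nbhs_nbhs.
  move=> ne; have <- : A `&` C1 = A; last first.
    move=> x [Ax C1x]; have : (B `&` C1) x by split=> //; exact: AB.
    by rewrite -C1E C2E => -[].
  apply: cA => //; first by exists C1.
  exists C2 => //; apply/seteqP; split=> x [Ax Cx]; split=> //.
    have : (B `&` C1) x by split=> //; exact: AB.
    by rewrite -C1E C2E => -[].
  have : (B `&` C2) x by split=> //; exact: AB.
  by rewrite -C2E C1E => -[].
rewrite C2E; apply/setIidPl => x /BA; move: AU => /closureS /(_ x).
by rewrite -(closure_id C2).1.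
Qed.

End Connectedness.

Section MetricLemmas.
Context {R : realType} {X : metricType R}.
Implicit Types (A B C U : set X) (x y z : X) (u : nat -> X).

Lemma open_mdist U :
  (forall x, U x -> exists2 e : R, 0 < e & forall y, mdist x y < e -> U y) ->
  open U.
Proof.
move=> H; rewrite openE => x /H[e e0 eU]; apply/nbhs_ballP; exists e => //= y.
by rewrite ballEmdist; exact: eU.
Qed.

Lemma nbhs_mdist U x : nbhs x U ->
  exists2 e : R, 0 < e & forall y, mdist x y < e -> U y.
Proof.
move=> /nbhs_ballP[e /= e0 eU]; exists e => // y xy.
by apply: eU; rewrite ballEmdist.
Qed.

Lemma open_mdistP U x : open U -> U x ->
  exists2 e : R, 0 < e & forall y, mdist x y < e -> U y.
Proof. by move=> oU Ux; apply: nbhs_mdist; exact: open_nbhs_nbhs. Qed.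

Lemma mdist_nbhs x (e : R) : 0 < e -> nbhs x [set y | mdist x y < e].
Proof. by move=> e0; rewrite -ballEmdist; exact: nbhsx_ballx. Qed.

Lemma open_mball x (e : R) : open [set y | mdist x y < e].
Proof.
apply: open_mdist => y /= xy; exists (e - mdist x y); first by rewrite subr_gt0.
move=> z; rewrite ltrBrDl; apply: le_lt_trans; exact: metric_triangle.
Qed.

Lemma closed_point x : closed [set x].
Proof.
by apply: accessible_closed_set1; apply: hausdorff_accessible; exact: metric_hausdorff.
Qed.

Lemma continuous_mdist (f : X -> X) x (e : R) : continuous f -> 0 < e ->
  exists2 d : R, 0 < d & forall y, mdist x y < d -> mdist (f x) (f y) < e.
Proof.
move=> cf e0; apply: (@nbhs_mdist (f @^-1` [set y | mdist (f x) y < e])).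
by apply: cf; exact: mdist_nbhs.
Qed.

Lemma connected_near C x y (e : R) : connected C -> C x -> C y -> x <> y ->
  0 < e -> exists z, [/\ C z, z <> x & mdist x z < e].
Proof.
move=> cC Cx Cy xy e0.
have [||||z [Cz /= xz zx]] := @connected_meet_open _ C [set z | mdist x z < e] (~` [set x]) x y cC
    (open_mball _ _) _ _ Cx _ Cy _.
- by apply: closed_openC; exact: closed_point.
- by move=> z Cz; have [->|zx] := pselect (z = x); [left; rewrite /= mdistxx|right].
- by rewrite /= mdistxx.
- by move=> /= yx; exact: xy.
by exists z.
Qed.

Definition acc u q := forall (e : R) n, 0 < e ->
  exists2 i, (n <= i)%N & mdist q (u i) < e.

Lemma acc_exists u : compact [set: X] -> exists q, acc u q.
Proof.
move=> cX; have [q [_ qc]] := cX (u @ \oo) _ (filterT).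
exists q => e n e0.
have := qc [set z | exists2 i, (n <= i)%N & z = u i] [set z | mdist q z < e].
case.
- by exists n => // i /= ni; exists i.
- exact: mdist_nbhs.
- by move=> z [[i ni ->] /=]; exists i.
Qed.

Lemma acc_closed u q C n : closed C -> (forall i, (n <= i)%N -> C (u i)) ->
  acc u q -> C q.
Proof.
move=> cC Cu uq; apply: contrapT => nCq.
have [e e0 eC] := @open_mdistP (~` C) q (closed_openC cC) nCq.
by have [i ni qi] := uq _ n e0; exact: (eC _ qi (Cu _ ni)).
Qed.

Lemma acc_open u q U n : open U -> U q -> acc u q ->
  exists2 i, (n <= i)%N & U (u i).
Proof.
move=> oU Uq uq; have [e e0 eU] := open_mdistP oU Uq.
by have [i ni qi] := uq _ n e0; exists i => //; exact: eU.
Qed.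

Lemma acc_continuous u q (f : X -> X) : continuous f -> acc u q ->
  acc (f \o u) (f q).
Proof.
move=> cf uq e n e0; have [d d0 dP] := continuous_mdist q cf e0.
by have [i ni qi] := uq _ n d0; exists i => //; exact: dP.
Qed.

Lemma acc_shift u q k : acc (fun i => u (i + k)%N) q -> acc u q.
Proof.
move=> uq e n e0; have [i ni qi] := uq _ n e0; exists (i + k)%N => //.
exact: leq_trans (leq_addr _ _).
Qed.

(** Otherwise the terms that stay [e] away from [q] would themselves accumulate, at a point other
    than [q]. *)
Lemma acc_cvg u q : compact [set: X] -> (forall q', acc u q' -> q' = q) ->
  forall e : R, 0 < e -> exists n, forall i, (n <= i)%N -> mdist q (u i) < e.
Proof.
move=> cX uniq e e0; apply: contrapT => nex.
have /choice[w wP] : forall n, exists i, (n <= i)%N /\ ~ mdist q (u i) < e.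
  move=> n; apply: contrapT => H; apply: nex; exists n => i ni.
  by apply: contrapT => qi; apply: H; exists i.
have [q' q'P] := acc_exists (u \o w) cX.
have q'q : q' = q.
  apply: uniq => d n d0; have [i ni qi] := q'P _ n d0; exists (w i) => //.
  by apply: leq_trans ni _; case: (wP i).
have [i _] := q'P _ 0%N e0; rewrite q'q => /=; by case: (wP i).
Qed.

End MetricLemmas.

(** * Arcs in locally connected compact spaces *)

Section Truncn.
Context {R : realType}.

(** Makes dyadic cells nested: dividing the index of the fine cell of [t] by the refinement factor
    gives the index of the coarse cell. For negative [t] both sides are the default 0. *)
Lemma truncn_divn (t : R) q : (0 < q)%N ->
  (Num.truncn (t * q%:R) %/ q)%N = Num.truncn t.
Proof.
move=> q0; have q0' : 0 < q%:R :> R by rewrite ltr0n.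
have [t0|t0] := ltP t 0.
  have trunc0 (u : R) : u < 0 -> Num.truncn u = 0%N.
    move=> u0; apply/eqP; rewrite -leqn0 truncn_le_nat; exact: lt_trans u0 _.
  by rewrite !trunc0 ?div0n // nmulr_rlt0.
have /andP[tl tr] := truncn_itv (mulr_ge0 t0 (ltW q0')).
set n := Num.truncn _ in tl tr *; apply/esym/truncn_def.
rewrite -(ler_pM2r q0') -(ltr_pM2r q0') -!natrM.
apply/andP; split; first by apply: le_trans tl; rewrite ler_nat leq_trunc_div.
by apply: lt_le_trans tr _; rewrite ler_nat ltn_ceil.
Qed.

Lemma truncn_near (u v : R) : u < v + 1 -> (Num.truncn u <= (Num.truncn v).+1)%N.
Proof.
move=> uv; rewrite truncn_le_nat; apply: lt_le_trans uv _.
by rewrite [leRHS]mulrSr lerD2r; apply/ltW/truncnS_gt.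
Qed.

Lemma exp2_gt (c : R) : exists k, c < 2 ^+ k.
Proof.
exists (Num.truncn c).+1; apply: lt_trans (truncnS_gt c) _.
by rewrite -natrX ltr_nat ltn_expl.
Qed.

End Truncn.

Section LocalPaths.
Context {R : realType} {X : metricType R}.
Implicit Types (A U : set X) (x y z : X).

(** The Lebesgue number lemma for a relation instead of a cover, so that it yields both uniform
    local connectedness and uniform continuity. *)
Lemma lebesgue_number (P : X -> X -> Prop) : compact [set: X] ->
  (forall x, exists2 r : R, 0 < r &
     forall y z, mdist x y < r -> mdist x z < r -> P y z) ->
  exists2 d : R, 0 < d & forall y z, mdist y z < d -> P y z.
Proof.
move=> /compact_near_coveringP cn locP.
pose Q (d : R) y := forall z, mdist y z < d -> P y z.
have : \forall d \near 0^'+, [set: X] `<=` Q d.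
  apply: cn => x _; have [r r0 rP] := locP x.
  have r20 : 0 < r / 2 by rewrite divr_gt0.
  exists ([set y | mdist x y < r / 2], [set d | d < r / 2]) => /=.
    by split; [exact: mdist_nbhs|exact: nbhs_right_lt].
  move=> [y d] /= [xy dr] z yz; apply: rP; first by lra.
  by apply: le_lt_trans (metric_triangle x y z) _; lra.
move=> dP; have [d [dQ d0]] : exists d, ([set: X] `<=` Q d) /\ 0 < d.
  by apply: (@filter_ex _ (0^'+)); apply: filterI => //; exact: nbhs_right_gt.
by exists d => // y z; exact: dQ.
Qed.

Lemma continuous_realP (g : R -> X) : continuous g <->
  forall t (e : R), 0 < e ->
    exists2 d : R, 0 < d & forall s, `|t - s| < d -> mdist (g t) (g s) < e.
Proof.
split=> [cg t e e0|H t U /nbhs_mdist[e e0 eU]].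
  have /nbhs_ballP[d /= d0 dP] : nbhs t (g @^-1` [set y | mdist (g t) y < e]).
    by apply: cg; exact: mdist_nbhs.
  by exists d => // s /dP.
have [d d0 dP] := H t e e0; apply/nbhs_ballP; exists d => //= s /dP.
exact: eU.
Qed.

Lemma uniform_local_connectedness : compact [set: X] ->
  locally_connected [set: X] -> forall e : R, 0 < e ->
  exists2 d : R, 0 < d & forall x y, mdist x y < d ->
    exists A, [/\ connected A, A x, A y & forall z, A z -> mdist x z < e].
Proof.
move=> cX lcX e e0; apply: lebesgue_number => // x.
have e20 : 0 < e / 2 by rewrite divr_gt0.
have [V [oV Vx]] := lcX x [set y | mdist x y < e / 2] I (open_mball _ _)
  (eq_ind_r (fun r => r < e / 2) e20 (mdistxx x)).
rewrite setTI => cV VB; have [r r0 rV] := open_mdistP oV Vx.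
exists r => // y z /rV Vy /rV Vz; exists V; split=> // w Vw.
have := metric_triangle y x w; have /= := VB _ Vw; have /= := VB _ Vy.
by rewrite (metric_sym y x); lra.
Qed.

(** The [e]-neighbourhoods of the reachable and of the unreachable points of [A] are open and cover
    [A]. A common point would link a reachable point to an unreachable one in two steps. Chains are
    continued by their last point, so that they can later be padded to a common length. *)
Lemma connected_chain A a b (e : R) : connected A -> A a -> A b -> 0 < e ->
  exists (L : nat) (c : nat -> X), [/\ c 0%N = a, forall j, (L <= j)%N -> c j = b,
    forall j, A (c j) & forall j, mdist (c j) (c j.+1) < e].
Proof.
move=> cA Aa Ab e0.
pose chain z := exists (L : nat) (c : nat -> X), [/\ c 0%N = a,
  forall j, (L <= j)%N -> c j = z, forall j, A (c j) &
  forall j, mdist (c j) (c j.+1) < e].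
have chain_step y z : chain y -> A z -> mdist y z < e -> chain z.
  move=> [L [c [c0 cL cA' ce]]] Az yz.
  exists L.+1, (fun j => if (j <= L)%N then c j else z); split=> //.
  - by move=> j Lj; rewrite leqNgt Lj.
  - by move=> j; case: ifP.
  - move=> j; have [jL|Lj] := ltnP j L; first by rewrite (ltnW jL).
    case: ifP => jL; last by rewrite mdistxx.
    by rewrite cL.
apply: contrapT => nb.
pose near (B : set X) := \bigcup_(y in B) [set z | mdist y z < e].
have onear B : open (near B) by apply: bigcup_open => y _; exact: open_mball.
have [|||x [Ax [y [Ay cy] /= yx] [z [Az ncz] /= zx]]] :=
  @connected_meet_open _ A (near [set z | A z /\ chain z])
    (near [set z | A z /\ ~ chain z]) a b cA (onear _) (onear _) _ Aa _ Ab _.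
- move=> z Az; have [cz|ncz] := pselect (chain z); [left|right];
    by exists z => //=; rewrite mdistxx.
- exists a; rewrite /= ?mdistxx //; split=> //.
  by exists 0%N, (fun=> a); split=> // j; rewrite mdistxx.
- by exists b; rewrite /= ?mdistxx.
apply: ncz; apply: (chain_step x _ _ Az); last by rewrite metric_sym.
exact: (chain_step y _ cy Ax yx).
Qed.

Section ShortPath.
Hypotheses (cX : compact [set: X]) (lcX : locally_connected [set: X]).

(* The path is the uniform limit of step functions [G k]: the vertices [P_k] are
   indexed by the dyadic subdivision of [0, 1] into [2 ^ M_k] intervals,
   consecutive vertices are [delta k]-close, and [P_(k+1)] interpolates between
   them by chains inside connected sets of radius [eps k]. *)
Lemma short_path (e : R) : 0 < e -> exists2 d : R, 0 < d &
  forall x y, mdist x y < d -> exists g : R -> X,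
    [/\ continuous g, g 0 = x, g 1 = y & forall t, mdist x (g t) < e].
Proof.
(* The [eps k] sum to [2 * eps 0 = e / 4], and the initial step function is within [eps 0 = e / 8]
   of [x], so the limit path stays within [3 e / 8] of [x]. *)
move=> e0; pose eps k : R := e / 8 / 2 ^+ k.
have eps0 k : 0 < eps k by rewrite !divr_gt0 // exprn_gt0.
have epsS k : eps k = eps k.+1 * 2 by rewrite /eps exprSr invfM mulrA divfK // pnatr_eq0.
have /choice[delta deltaP] k : exists d, [/\ 0 < d, d <= eps k &
    forall x y, mdist x y < d -> exists A, [/\ connected A, A x, A y &
      forall z, A z -> mdist x z < eps k]].
  have [d d0 dP] := uniform_local_connectedness cX lcX (eps0 k).
  exists (Num.min d (eps k)); split; first by rewrite lt_min d0 eps0.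
    by rewrite ge_min lexx orbT.
  by move=> x y; rewrite lt_min => /andP[/dP].
have delta0 k : 0 < delta k by case: (deltaP k).
exists (delta 0%N) => // x y xy.
pose valid k (s : nat * (nat -> X)) := [/\ s.2 0%N = x,
  forall i, (2 ^ s.1 <= i)%N -> s.2 i = y &
  forall i, mdist (s.2 i) (s.2 i.+1) < delta k].
pose refines k (s s' : nat * (nat -> X)) := exists m, s'.1 = (s.1 + m)%N /\
  forall i j, (j < 2 ^ m)%N -> mdist (s.2 i) (s'.2 (i * 2 ^ m + j)%N) < eps k.
have refine k s : valid k s -> exists s', valid k.+1 s' /\ refines k s s'.
  case: s => M P [/= P0 PM Pd].
  have /choice[c cP] i : exists Lc : nat * (nat -> X), [/\ Lc.2 0%N = P i,
      forall j, (Lc.1 <= j)%N -> Lc.2 j = P i.+1,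
      forall j, mdist (P i) (Lc.2 j) < eps k &
      forall j, mdist (Lc.2 j) (Lc.2 j.+1) < delta k.+1].
    have [_ _ dP] := deltaP k; have [A [cA APi APi1 AP]] := dP _ _ (Pd i).
    have [L [c [c0 cL Ac cd]]] := connected_chain cA APi APi1 (delta0 k.+1).
    by exists (L, c); split=> // j; exact: AP.
  (* One exponent for all intervals: [2 ^ m] exceeds every chain length, and shorter chains are
     padded by their constant tails. *)
  pose m := (\max_(i < 2 ^ M) (c i).1)%N.
  have Lm i : (i < 2 ^ M)%N -> ((c i).1 <= 2 ^ m)%N.
    move=> iM; apply: leq_trans (ltnW (ltn_expl m (ltnSn 1))).
    exact: (@leq_bigmax _ (fun i : 'I_(2 ^ M) => (c i).1) (Ordinal iM)).
  have m0 : (0 < 2 ^ m)%N by rewrite expn_gt0.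
  pose P' n := if (n < 2 ^ M * 2 ^ m)%N then (c (n %/ 2 ^ m)%N).2 (n %% 2 ^ m)%N else y.
  have P'S i : (i <= 2 ^ M)%N -> P' (i * 2 ^ m)%N = P i.
    rewrite leq_eqVlt => /predU1P[->|iM]; first by rewrite /P' ltnn PM.
    by rewrite /P' ltn_pmul2r // iM mulnK // modnMl; case: (cP i).
  exists ((M + m)%N, P'); split; last first.
    exists m; split=> // i j jm /=; have [iM|iM] := ltnP i (2 ^ M)%N; last first.
      rewrite /P' ltnNge (leq_trans _ (leq_addr _ _)) ?leq_pmul2r //=.
      by rewrite PM // mdistxx.
    rewrite /P' ifT; last first.
      by apply: leq_trans (_ : (i.+1 * 2 ^ m <= _)%N); rewrite ?leq_pmul2r // mulSn addnC ltn_add2r.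
    by rewrite divnMDl // divn_small // addn0; case: (cP i).
  split=> /=.
  - by have := P'S 0%N (leq0n _); rewrite mul0n P0.
  - by move=> i; rewrite expnD /P' => Mi; rewrite ltnNge Mi.
  move=> n; have [nM|nM] := ltnP n (2 ^ M * 2 ^ m)%N; last first.
    by rewrite /P' !ltnNge nM (leqW nM) /= mdistxx.
  pose i := (n %/ 2 ^ m)%N; pose j := (n %% 2 ^ m)%N.
  have nE : n = (i * 2 ^ m + j)%N := divn_eq n (2 ^ m).
  have iM : (i < 2 ^ M)%N by rewrite ltn_divLR.
  have jm : (j < 2 ^ m)%N by rewrite ltn_pmod.
  have [_ cL _ cd] := cP i.
  have P'n : P' n = (c i).2 j by rewrite /P' nM.
  rewrite P'n; have [jm1|jm1] := ltnP j.+1 (2 ^ m)%N.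
    have -> : P' n.+1 = (c i).2 j.+1; last exact: cd.
    have nM1 : (n.+1 < 2 ^ M * 2 ^ m)%N.
      by apply: leq_trans (_ : (i.+1 * 2 ^ m <= _)%N); rewrite ?leq_pmul2r // nE mulSn -addnS addnC ltn_add2r.
    by rewrite /P' nM1 nE -addnS divnMDl // divn_small // addn0 modnMDl modn_small.
  have jE : j.+1 = (2 ^ m)%N by apply/eqP; rewrite eqn_leq jm.
  have -> : P' n.+1 = (c i).2 j.+1; last exact: cd.
  rewrite nE -addnS jE -mulSnr P'S // cL //; exact: Lm.
have /choice[next nextP] (ks : nat * (nat * (nat -> X))) :
    exists s', valid ks.1 ks.2 -> valid ks.1.+1 s' /\ refines ks.1 ks.2 s'.
  have [v|nv] := pselect (valid ks.1 ks.2); last by exists ks.2.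
  by have [s' s'P] := refine _ _ v; exists s'.
pose s := nat_rect (fun=> (nat * (nat -> X))%type)
  (0%N, fun i => if i == 0%N then x else y) (fun k s => next (k, s)).
have sv k : valid k (s k).
  elim: k => [|k IH]; last by have [] := nextP (k, s k) IH.
  split=> //= [i|i]; first by rewrite expn0; case: i.
  by case: i => //= i; rewrite mdistxx.
have sr k : refines k (s k) (s k.+1) by have [] := nextP (k, s k) (sv k).
pose G (k : nat) (t : R) := (s k).2 (Num.truncn (t * 2 ^+ (s k).1)).
have Gstep k t : mdist (G k t) (G k.+1 t) < eps k.
  rewrite /G; have [m [-> mP]] := sr k.
  rewrite exprD mulrA -[2 ^+ m]natrX.
  have m0 : (0 < 2 ^ m)%N by rewrite expn_gt0.
  rewrite [Num.truncn (_ * (2 ^ m)%:R)](divn_eq _ (2 ^ m)%N) truncn_divn //.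
  by apply: mP; rewrite ltn_pmod.
have Gtele k l t : mdist (G k t) (G (k + l)%N t) <= eps k * 2 - eps (k + l)%N * 2.
  elim: l => [|l IH]; first by rewrite addn0 mdistxx subrr.
  have := metric_triangle (G k t) (G (k + l)%N t) (G (k + l).+1 t).
  have := Gstep (k + l)%N t; rewrite addnS; have := epsS (k + l)%N; lra.
have /choice[g gP] t : exists q, acc (fun k => G k t) q.
  by have [q qP] := acc_exists (fun k => G k t) cX; exists q.
have Gg k t : mdist (G k t) (g t) <= eps k * 2.
  apply/ler_addgt0Pr => r r0; have [l kl gl] := gP t r k r0.
  have := metric_triangle (G k t) (G l t) (g t).
  have := Gtele k (l - k)%N t; rewrite subnKC // (metric_sym (G l t)).
  by have := eps0 l; lra.
have g_eq t z : (forall k, G k t = z) -> g t = z.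
  move=> Gz; apply: mdist_positivity; apply/eqP; rewrite eq_le mdist_ge0 andbT.
  apply/ler_addgt0Pr => r r0; rewrite add0r.
  by have [l _ /ltW] := gP t r 0%N r0; rewrite Gz.
exists g; split.
- apply/continuous_realP => t r r0.
  have [k kP] := exp2_gt (e / 8 / (r / 5)).
  (* Passing from [g t] to [G k t], then [G k u], then [g u] costs at most [2 + 1 + 2] times
     [eps k]. *)
  have ek : eps k < r / 5.
    have r50 : 0 < r / 5 by rewrite divr_gt0.
    rewrite /eps ltr_pdivrMr ?exprn_gt0 // [ltRHS]mulrC.
    by rewrite -(ltr_pdivrMr _ _ r50).
  have [_ _ sd] := sv k.
  have M0 : 0 < 2 ^+ (s k).1 :> R by rewrite exprn_gt0.
  exists (2 ^+ (s k).1)^-1; first by rewrite invr_gt0.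
  move=> u; rewrite -[_^-1]mul1r ltr_pdivlMr // -(gtr0_norm M0) -normrM mulrBl.
  move=> tu; have Gd : mdist (G k t) (G k u) < delta k.
    rewrite /G; set a := Num.truncn _; set b := Num.truncn _.
    have ab : (a <= b.+1)%N by apply: truncn_near; have := ler_norm (t * 2 ^+ (s k).1 - u * 2 ^+ (s k).1); lra.
    have ba : (b <= a.+1)%N by apply: truncn_near; move: tu; rewrite distrC => tu; have := ler_norm (u * 2 ^+ (s k).1 - t * 2 ^+ (s k).1); lra.
    have [->|->|->] : [\/ a = b, a = b.+1 | b = a.+1] 
      by case: (ltngtP a b) => h; [constructor 3|constructor 2|constructor 1]; lia.
    + by rewrite mdistxx.
    + by rewrite metric_sym.
    + by [].
  have [_ de _] := deltaP k.
  have := metric_triangle (g t) (G k t) (g u).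
  have := metric_triangle (G k t) (G k u) (g u).
  have := Gg k t; have := Gg k u; rewrite (metric_sym (g t) (G k t)); lra.
- by apply: g_eq => k; rewrite /G mul0r truncn0; case: (sv k).
- apply: g_eq => k; rewrite /G mul1r -natrX natrK; case: (sv k) => _ + _.
  by apply.
- move=> t; have := Gg 0%N t; have := metric_triangle x (G 0%N t) (g t).
  have xG : mdist x (G 0%N t) <= eps 0%N.
    have [_ de _] := deltaP 0%N; rewrite /G /=; case: ifP => _; last lra.
    by rewrite mdistxx ltW.
  have : eps 0%N = e / 8 by rewrite /eps expr0 divr1.
  by lra.
Qed.
End ShortPath.
End LocalPaths.

Section Joined.
Context {R : realType} {X : metricType R}.
Implicit Types (A U : set X) (x y z a b : X).

Lemma continuous_glue (g h : R -> X) c : continuous g -> continuous h ->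
  g c = h c -> continuous (fun t => if t <= c then g t else h t).
Proof.
move=> /continuous_realP cg /continuous_realP ch E; apply/continuous_realP => t e e0.
have [d d0 dP] := cg t e e0; have [d' d'0 d'P] := ch t e e0.
have [tc|ct|tc] := ltgtP t c.
- exists (Num.min d (c - t)); first by rewrite lt_min d0 subr_gt0.
  move=> s; rewrite lt_min => /andP[sd]; rewrite ltr_norml => /andP[sc _].
  by rewrite ifT; [exact: dP|lra].
- exists (Num.min d' (t - c)); first by rewrite lt_min d'0 subr_gt0.
  move=> s; rewrite lt_min => /andP[sd]; rewrite ltr_norml => /andP[_ sc].
  by rewrite ifF; [exact: d'P|apply/negbTE; rewrite -ltNge; lra].
- exists (Num.min d d'); first by rewrite lt_min d0.
  move=> s; rewrite lt_min => /andP[/dP sd /d'P sd'].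
  by case: ifP => // _; rewrite tc E -tc.
Qed.

Lemma continuous_affine (g : R -> X) (u v : R) : continuous g ->
  continuous (fun t => g (u * t + v)).
Proof.
move=> cg t; apply: (@continuous_comp _ _ _ (fun t => u * t + v) g); last exact: cg.
by apply: cvgD; [apply: cvgM; [exact: cvg_cst|exact: cvg_id]|exact: cvg_cst].
Qed.

Definition joined U a b := exists g : R -> X,
  [/\ continuous g, g 0 = a, g 1 = b & forall t, U (g t)].

Lemma joined_trans U a b c : joined U a b -> joined U b c -> joined U a c.
Proof.
move=> [g [cg g0 g1 gU]] [h [ch h0 h1 hU]].
exists (fun t => if t <= 1 / 2 then g (2 * t + 0) else h (2 * t + (- 1))); split.
- apply: continuous_glue; [exact: continuous_affine|exact: continuous_affine|].
  have -> : 2 * (1 / 2) + 0 = 1 :> R by field.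
  have -> : 2 * (1 / 2) + -1 = 0 :> R by field.
  by rewrite g1 h0.
- by rewrite ifT ?mulr0 ?addr0 //; lra.
- rewrite ifF; last by apply/negbTE; rewrite -ltNge; lra.
  by have -> : 2 * 1 + -1 = 1 :> R by ring.
- by move=> t; case: ifP.
Qed.

(** By [short_path], nearby points of [U] are joined inside a small ball contained in [U]. Hence the
    points joined to [a] and those not joined to [a] form two open sets. *)
Lemma open_connected_joined U a b : compact [set: X] ->
  locally_connected [set: X] -> open U -> connected U -> U a -> U b ->
  joined U a b.
Proof.
move=> cX lcX oU cU Ua Ub; apply: contrapT => nab.
have loc z : U z -> exists2 d : R, 0 < d & forall y, mdist z y < d ->
    U y /\ joined U z y.
  move=> Uz; have [r r0 rP] := open_mdistP oU Uz.
  have [d d0 dP] := short_path cX lcX r0; exists (Num.min d r); first by rewrite lt_min d0.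
  move=> y; rewrite lt_min => /andP[/dP[g [cg g0 g1 gz]] /rP Uy]; split=> //.
  by exists g; split=> // t; apply: rP.
have joined_sym x y : joined U x y -> joined U y x.
  move=> [g [cg g0 g1 gU]]; exists (fun t => g (- 1 * t + 1)).
  split; [exact: continuous_affine|by rewrite mulr0 add0r| |by []].
  by rewrite mulr1 addNr.
have [|||||z [_ [Uz jz] [_ njz]]] := @connected_meet_open _ U
  [set z | U z /\ joined U a z] [set z | U z /\ ~ joined U a z] a b cU _ _ _ Ua _ Ub _.
- apply: open_mdist => z [/loc[d d0 dP] jz]; exists d => // y /dP[Uy zy].
  by split=> //; exact: joined_trans zy.
- apply: open_mdist => z [/loc[d d0 dP] njz]; exists d => // y /dP[Uy zy].
  by split=> // jy; apply: njz; apply: joined_trans jy _; exact: joined_sym.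
- by move=> z Uz; have [jz|nz] := pselect (joined U a z); [left|right].
- by split=> //; exists (fun=> a); split=> // t; exact: cvg_cst.
- by split.
- exact: njz.
Qed.

End Joined.

(** * Erasing the loops of a path *)

Section ClosedReal.
Context {R : realType}.
Implicit Types (C : set R) (s t u v : R).

Lemma closed_realP C t : closed C ->
  (forall e : R, 0 < e -> exists2 s, C s & `|t - s| < e) -> C t.
Proof.
move=> cC H; rewrite (closure_id C).1 // => U /nbhs_ballP[e /= e0 eU].
by have [s Cs ts] := H e e0; exists s; split=> //; exact: eU.
Qed.

Lemma last_before C s t : closed C -> C s -> s <= t ->
  exists u, [/\ s <= u, u <= t, C u & forall r, u < r -> r <= t -> ~ C r].
Proof.
move=> cC Cs st; pose A := [set r | C r /\ r <= t].
have supA : has_sup A by split; [exists s|exists t => r []].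
have sA : s <= sup A by apply: ub_le_sup => //; case: supA.
exists (sup A); split=> //.
- by apply: ge_sup => [|r []//]; case: supA.
- apply: closed_realP => // e e0; have [r [Cr rt] er] := sup_adherent e0 supA.
  exists r => //; rewrite ger0_norm; first by lra.
  by rewrite subr_ge0; apply: ub_le_sup => //; case: supA.
- move=> r ur rt Cr; have : r <= sup A by apply: ub_le_sup => //; case: supA.
  by rewrite leNgt ur.
Qed.

Lemma first_after C s t : closed C -> C t -> s <= t ->
  exists u, [/\ s <= u, u <= t, C u & forall r, s <= r -> r < u -> ~ C r].
Proof.
move=> cC Ct st; have [|||u [tu us Cu uP]] := @last_before (-%R @^-1` C) (- t) (- s).
- by apply: closed_comp => // r _; exact: opp_continuous.
- by rewrite /= opprK.
- by rewrite lerN2.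
exists (- u); split=> //; [by rewrite lerNr|by rewrite lerNl|].
move=> r sr ru Cr; apply: (uP (- r)); [by rewrite ltrNr|by rewrite lerN2|].
by rewrite /= opprK.
Qed.

End ClosedReal.

Section WeakArc.
Context {R : realType} {X : metricType R}.
Variable g : R -> X.
Hypothesis cg : continuous g.
Implicit Types (s t u v r : R) (G : set R).

(** A finite subcover taken from a chain reduces to its largest member. Here compactness is applied
    along the filter of upper tails of the chain. *)
Lemma chain_cover (F : set (set R)) s t : s <= t -> total_on F subset ->
  (forall G, F G -> open G) -> `[s, t] `<=` \bigcup_(G in F) G ->
  exists2 G, F G & `[s, t] `<=` G.
Proof.
move=> st Ftot oF cov.
have [G0 FG0 _] : (\bigcup_(G in F) G) s by apply: cov; rewrite /= in_itv /= lexx.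
pose Phi := filter_from F (fun G => [set G' | F G' /\ G `<=` G']).
have PhiF : ProperFilter Phi.
  apply: filter_from_proper; last first.
    by move=> G FG; exists G; split.
  apply: filter_from_filter; first by exists G0.
  move=> G G' FG FG'; have [GG'|G'G] := Ftot _ _ FG FG'.
    by exists G' => // G2 [FG2 G'G2]; split; split=> //; exact: subset_trans G'G2.
  by exists G => // G2 [FG2 GG2]; split; split=> //; exact: subset_trans GG2.
have /compact_near_coveringP/(_ _ Phi (fun G r => G r)) := @segment_compact R s t.
case=> [r /cov[G FG Gr]|G1 FG1 G1P].
  exists (G, [set G' | F G' /\ G `<=` G']) => /=.
    by split; [apply: open_nbhs_nbhs; split=> //; exact: oF|by exists G].
  by move=> [r' G'] /= [Gr' [_]]; apply.
by exists G1 => //; exact: (G1P G1 (conj FG1 (fun r Gr => Gr))).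
Qed.

(** On each component interval of an open [G] the path makes a loop, so deleting [G] from the time
    interval erases loops. *)
Let gaps_closed G := forall s t, s < t -> 0 <= s -> t <= 1 -> ~ G s -> ~ G t ->
  (forall r, s < r -> r < t -> G r) -> g s = g t.

Let P G := [/\ open G, forall t, G t -> 0 < t < 1 & gaps_closed G].

(** Given a gap []s, t[] of the union, a slightly smaller compact interval lies in one member of the
    chain. The gap of that member around it has ends [u], [v] close to [s], [t], and [g u = g v];
    continuity then gives [g s = g t]. *)
Let P_chain (F : set (set R)) : F `<=` P -> total_on F subset ->
  P (\bigcup_(G in F) G).
Proof.
move=> FP Ftot; split.
- by apply: bigcup_open => G /FP[].
- by move=> t [G /FP[_ + _]]; exact.
move=> s t st s0 t1 ns nt gap; apply: mdist_positivity.
apply/eqP; rewrite eq_le mdist_ge0 andbT; apply/ler_addgt0Pr => e e0; rewrite add0r.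
have e20 : 0 < e / 2 by rewrite divr_gt0.
have [d d0 dP] := (continuous_realP g).1 cg s _ e20.
have [d' d'0 d'P] := (continuous_realP g).1 cg t _ e20.
pose m := Num.min (Num.min d d') (t - s).
have m0 : 0 < m by rewrite !lt_min d0 d'0 subr_gt0.
have md : m <= d by rewrite !ge_min lexx.
have md' : m <= d' by rewrite !ge_min lexx orbT.
have mst : m <= t - s by rewrite ge_min lexx orbT.
have [||||G FG sub] := @chain_cover F (s + m / 3) (t - m / 3).
- by lra.
- by [].
- by move=> G /FP[].
- by move=> r; rewrite /= in_itv /= => /andP[sr rt]; apply: gap; lra.
have [oG G01 Ggap] := FP _ FG.
have cG : closed (~` G) by exact: open_closedC.
have [|||u [su us nGu uP]] := @last_before _ (~` G) s (s + m / 3) => //.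
- by move=> Gs; apply: ns; exists G.
- by lra.
have [|||v [tv vt nGv vP]] := @first_after _ (~` G) (t - m / 3) t => //.
- by move=> Gt; apply: nt; exists G.
- by lra.
have guv : g u = g v.
  apply: Ggap => //; try lra.
  move=> r ur rv; have [rs|sr] := leP r (s + m / 3).
    by apply: contrapT; exact: uP.
  have [tr|rt] := leP (t - m / 3) r; first by apply: contrapT; exact: vP.
  by apply: sub; rewrite /= in_itv /= !ltW.
have := metric_triangle (g s) (g u) (g t); rewrite {2}guv (metric_sym (g v)).
have : mdist (g s) (g u) < e / 2 by apply: dP; rewrite ltr_norml; lra.
have : mdist (g t) (g v) < e / 2 by apply: d'P; rewrite ltr_norml; lra.
by lra.
Qed.

(* A maximal [G] gives a minimal [K], so that [g] takes equal values at two points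
   of [K] only if they bound a gap of [K]. *)
Lemma loop_erased_set : exists K : set R,
  [/\ closed K, K 0, K 1, forall t, K t -> 0 <= t <= 1 &
      forall s t, K s -> K t -> s < t ->
        g s = g t <-> forall r, s < r -> r < t -> ~ K r].
Proof.
have [G [[oG G01 Ggap] Gmax]] := Zorn_bigcup P_chain.
exists (`[0, 1] `\` G); split.
- by apply: closedI; [exact: interval_closed|exact: open_closedC].
- by split; [rewrite /= in_itv /= lexx ler01|move=> /G01; rewrite ltxx].
- by split; [rewrite /= in_itv /= lexx ler01|move=> /G01; rewrite ltxx andbF].
- by move=> t [] /=; rewrite in_itv.
move=> s t [s01 nGs] [t01 nGt] st; move: s01 t01; rewrite /= !in_itv /= => s01 t01.
split=> [gst r sr rt [r01 nGr]|gap]; last first.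
  apply: Ggap => //; try lra.
  move=> r sr rt; apply: contrapT => nGr; apply: (gap r sr rt); split=> //.
  by rewrite /= in_itv /=; lra.
(* If [g s = g t] and [K] had a point between [s] and [t], excising the whole interval would enlarge
   the maximal [G]. *)
apply: (Gmax (G `|` `]s, t[)).
  split; first by left.
  by move=> /(_ r) BG; apply: nGr; apply: BG; right; rewrite /= in_itv /= sr.
split.
- by apply: openU => //; exact: interval_open.
- by move=> r' [/G01//|]; rewrite /= in_itv /= => /andP[? ?]; lra.
move=> u v uv u0 v1 nu nv gap.
have nGu : ~ G u by move=> Gu; apply: nu; left.
have nGv : ~ G v by move=> Gv; apply: nv; left.
(* A gap of the enlarged set either misses []s, t[], and is a gap of [G], or meets it, and is then
   exactly []s, t[], because [s] and [t] lie outside the enlarged set. *)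
have [[q [uq qv sq qt]]|nq] := pselect (exists q, [/\ u < q, q < v, s < q & q < t]); last first.
  apply: Ggap => // q uq qv; have [//|] := gap q uq qv.
  by rewrite /= in_itv /= => /andP[sq qt]; exfalso; apply: nq; exists q.
have us : u = s.
  have [us|su|//] := ltgtP u s; exfalso.
    have sv : s < v by lra.
    have [//|] := gap s us sv.
    by rewrite /= in_itv /= ltxx.
  by apply: nu; right; rewrite /= in_itv /= su; lra.
have vt : v = t.
  have [vt|tv|//] := ltgtP v t; exfalso.
    by apply: nv; right; rewrite /= in_itv /= vt andbT; lra.
  have ut : u < t by lra.
  have [//|] := gap t ut tv.
  by rewrite /= in_itv /= ltxx andbF.
by rewrite us vt.
Qed.

(** Take [w = g \o l], where [l t] is the last time of [K] up to [t]. The function [l] jumps over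
    the gaps of [K], but [g] agrees at both ends of a gap. Conversely equal values of [w] come from
    one time or from the two ends of a gap, and [l] has no value inside a gap. *)
Lemma weak_arc : exists w : R -> X,
  [/\ continuous w, w 0 = g 0 /\ w 1 = g 1, forall t, exists s, w t = g s,
      forall t, t <= 0 -> w t = w 0 &
      forall s r t, s <= r -> r <= t -> w s = w t -> w r = w s].
Proof.
have [K [cK K0 K1 K01 gK]] := loop_erased_set.
have /choice[l lP] t : exists u, [/\ K u, 0 <= t -> u <= t, t < 0 -> u = 0 &
    forall r, u < r -> r <= t -> ~ K r].
  have [t0|t0] := leP 0 t.
    have [u [_ ut Ku uP]] := last_before cK K0 t0.
    by exists u; split=> //; rewrite ltNge t0.
  by exists 0; split=> // r r0 rt /K01; lra.
have Kl t : K (l t) by case: (lP t).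
have l0 t : 0 <= l t by have := K01 _ (Kl t); lra.
have l_id t : K t -> l t = t.
  move=> Kt; have [_ lt _ nK] := lP t; have := K01 _ Kt => /andP[t0 _].
  apply/eqP; rewrite eq_le lt //=; rewrite leNgt; apply/negP => ltt.
  exact: nK ltt (lexx t) Kt.
have l_mono s t : s <= t -> l s <= l t.
  move=> st; have [s0|s0] := ltP s 0.
    by have [_ _ + _] := lP s => ->.
  have [_ ls _ _] := lP s; have [_ _ _ nK] := lP t.
  rewrite leNgt; apply/negP => tls; apply: (nK (l s)) => //.
  by apply: le_trans st; exact: ls.
(* The source of continuity: on an interval, [w] oscillates no more than [g] does. The point [u] is
   the first time of [K] after [s], which closes the gap that starts at [l s]. *)
have l_ne s t : s <= t -> g (l s) = g (l t) \/
    exists u v, [/\ s <= u <= t, s <= v <= t, g (l s) = g u & g (l t) = g v].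
  move=> st; have [Klt _ _ _] := lP t.
  have [lts|slt] := ltP (l t) s.
    left; congr g; apply/eqP; rewrite eq_le l_mono //= leNgt; apply/negP => lst.
    have [_ _ _ nK] := lP s; apply: (nK (l t)) => //; exact: ltW.
  have [t0|t0] := ltP t 0.
    left; have [_ _ /(_ t0) -> _] := lP t.
    by have [_ _ /(_ (le_lt_trans st t0)) -> _] := lP s.
  have ltt : l t <= t by case: (lP t) => _ /(_ t0).
  have [u [su ult Ku uP]] := first_after cK Klt slt.
  right; exists u, (l t); split=> //; [lra|lra|].
  have u0 : 0 <= u by have := K01 _ Ku; lra.
  have [s0|s0] := ltP s 0.
    have [_ _ /(_ s0) -> _] := lP s; congr g.
    apply/eqP; rewrite eq_le u0 /= leNgt; apply/negP => u0'.
    exact: uP (ltW s0) u0' K0.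
  have [_ /(_ s0) ls _ nK] := lP s.
  have [su'|us] := ltP s u; last first.
    have E : s = u by lra.
    by rewrite E l_id.
  have lsu : l s < u by lra.
  apply/(gK _ _ (Kl s) Ku lsu) => r lr ru Kr.
  have [rs|sr] := leP r s; first exact: nK rs Kr.
  exact: uP (ltW sr) ru Kr.
exists (g \o l); split=> /=.
- apply/continuous_realP => t e e0 /=; have e20 : 0 < e / 2 by rewrite divr_gt0.
  have close a b d : (forall s, `|t - s| < d -> mdist (g t) (g s) < e / 2) ->
      a <= b -> `|t - a| < d -> `|t - b| < d -> (a <= t <= b) ->
      mdist (g (l a)) (g (l b)) < e.
    move=> dP ab ta tb atb; have [->|] := l_ne _ _ ab; first by rewrite mdistxx.
    move=> [u [v [aub avb -> ->]]].
    have := metric_triangle (g u) (g t) (g v); rewrite (metric_sym (g u) (g t)).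
    have : mdist (g t) (g u) < e / 2 by apply: dP; move: ta tb; rewrite !ltr_norml; lra.
    have : mdist (g t) (g v) < e / 2 by apply: dP; move: ta tb; rewrite !ltr_norml; lra.
    by lra.
  have [d d0 dP] := (continuous_realP g).1 cg t _ e20; exists d => // s ts.
  have [st|ts'] := leP s t.
    by rewrite metric_sym; apply: (close s t d) => //; rewrite ?subrr ?normr0 ?st ?lexx.
  by apply: (close t s d) => //; rewrite ?subrr ?normr0 ?(ltW ts') ?lexx.
- by rewrite !l_id.
- by move=> t; exists (l t).
- move=> t; rewrite le_eqVlt => /predU1P[->//|t0]; rewrite (l_id _ K0).
  by have [_ _ /(_ t0) ->] := lP t.
move=> s r t sr rt; have ls := l_mono _ _ sr; have lr := l_mono _ _ rt.
have [lst|lts] := ltP (l s) (l t); last by move=> _; congr g; lra.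
move=> /(gK _ _ (Kl s) (Kl t) lst) nK.
have [E|sr'] := eqVneq (l r) (l s); first by rewrite E.
have [E|rt'] := eqVneq (l r) (l t); first by rewrite E; apply/esym/(gK _ _ (Kl s) (Kl t) lst).
exfalso; apply: (nK (l r)) => //; first by rewrite lt_neqAle eq_sym sr'.
by rewrite lt_neqAle rt'.
Qed.

End WeakArc.

(** * From weakly monotone paths to arcs *)

(** A continuous map from a compact set to a Hausdorff space is a quotient map onto its image. If
    continuity failed at [h s1], the points of [K] with [h] near [h s1] and [k] outside [W] would
    cluster at a point of the same fiber, where [k] is continuous. *)
Lemma factor_continuous (T1 T2 T3 : topologicalType) (K : set T1)
    (h : T1 -> T2) (k : T1 -> T3) :
  compact K -> hausdorff_space T2 -> K !=set0 ->
  {within K, continuous h} -> {within K, continuous k} ->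
  (forall s t, K s -> K t -> h s = h t -> k s = k t) ->
  exists a : T2 -> T3, (forall s, K s -> a (h s) = k s) /\
    {within h @` K, continuous a}.
Proof.
move=> cK T2H [s0 Ks0] ch ck hk.
pose a u := k (xget s0 [set s | K s /\ h s = u]).
have aE s : K s -> a (h s) = k s.
  move=> Ks; rewrite /a; case: xgetP => [s' _ [Ks' hs']|/(_ s)].
    exact: hk.
  by move=> /= H; exfalso; apply: H.
exists a; split=> //; apply/subspace_continuousP => _ [s1 Ks1 <-] W Ws1.
have {}Ws1 : nbhs (k s1) W by rewrite -aE.
apply: contrapT => nW.
pose Phi := filter_from (nbhs (h s1)) (fun N => [set s | [/\ K s, N (h s) & ~ W (k s)]]).
have PhiF : ProperFilter Phi.
  apply: filter_from_proper; last first.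
    move=> N Nh; apply: contrapT => Phi0; apply: nW.
    apply: filterS Nh => u Nu [s Ks hsu]; rewrite -hsu in Nu.
    suff : W (k s) by rewrite -aE // hsu.
    by apply: contrapT => nWs; apply: Phi0; exists s.
  apply: filter_from_filter; first by exists setT; exact: filterT.
  move=> N N' Nh N'h; exists (N `&` N'); first exact: filterI.
  by move=> s [Ks [Ns N's] nWs].
have PhiK N : nbhs (h s1) N -> Phi [set s | [/\ K s, N (h s) & ~ W (k s)]].
  by move=> Nh; exists N.
have [s [Ks sPhi]] : K `&` cluster Phi !=set0.
  by apply: cK; exists setT; [exact: filterT|move=> s []].
have hs : h s = h s1.
  apply: T2H => A B Ahs Bhs.
  have /subspace_continuousP/(_ s Ks A Ahs) /= sA := ch.
  have [s' [[Ks' Bs' _] /(_ Ks') As']] := sPhi _ _ (PhiK _ Bhs) sA.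
  by exists (h s').
have ks := hk _ _ Ks Ks1 hs; rewrite -ks in Ws1.
have /subspace_continuousP/(_ s Ks W Ws1) /= sW := ck.
have [s' [[Ks' _ nW'] /(_ Ks')]] := sPhi _ _ (PhiK _ filterT) sW.
exact: nW'.
Qed.

Section WeightedSup.
Context {R : realType} {T : Type}.

Lemma sum_half n : \sum_(i < n) (1 / 2 : R) ^+ i.+1 = 1 - (1 / 2) ^+ n.
Proof.
elim: n => [|n IH]; first by rewrite big_ord0 expr0 subrr.
by rewrite big_ord_recr /= IH exprS; field.
Qed.

(** [phi] is the series of the [u i / 2 ^ (i + 1)], taken as the supremum of its partial sums. The
    weights sum to 1, so a uniform error [e] is not amplified; each weight is positive, so a strict
    increase of one term is not lost. *)
Lemma weighted_sup (u : nat -> T -> R) (M : R) :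
  (forall i t, 0 <= u i t <= M) -> exists phi : T -> R,
  (forall s t (e : R), 0 <= e -> (forall i, u i s <= u i t + e) ->
     phi s <= phi t + e) /\
  (forall s t i, (forall j, u j s <= u j t) -> u i s < u i t -> phi s < phi t).
Proof.
move=> uM; pose c i : R := (1 / 2) ^+ i.+1.
have c0 i : 0 < c i by rewrite exprn_gt0 // divr_gt0.
pose S n t := \sum_(i < n) u i t * c i.
have S1 n (e : R) : 0 <= e -> \sum_(i < n) e * c i <= e.
  move=> e0; rewrite -mulr_sumr sum_half; apply: ler_piMr => //.
  by rewrite gerBl exprn_ge0 // divr_ge0.
have SM n t : S n t <= M.
  have M0 : 0 <= M by have /andP[] := uM 0%N t; exact: le_trans.
  apply: le_trans (S1 n M M0); apply: ler_sum => i _.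
  by rewrite ler_pM2r //; case/andP: (uM i t).
have S_mono n n' t : (n <= n')%N -> S n t <= S n' t.
  move=> /subnKC <-; elim: (n' - n)%N => [|k IH]; first by rewrite addn0.
  rewrite addnS; apply: le_trans IH _; rewrite /S big_ord_recr /= lerDl.
  by rewrite mulr_ge0 ?(ltW (c0 _)) //; case/andP: (uM (n + k)%N t).
have supS t : has_sup (range (S^~ t)).
  by split; [exists (S 0%N t), 0%N|exists M => _ [n _ <-]].
pose phi t := sup (range (S^~ t)).
have Sphi n t : S n t <= phi t by apply: ub_le_sup; [case: (supS t)|exists n].
have phi_le t b : (forall n, S n t <= b) -> phi t <= b.
  by move=> Sb; apply: ge_sup => [|_ [n _ <-]//]; case: (supS t).
exists phi; split=> [s t e e0 ust|s t i ust usti].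
  apply: phi_le => n; apply: le_trans (lerD (Sphi n t) (S1 n e e0)).
  rewrite /S -big_split /=; apply: ler_sum => j _.
  by rewrite -mulrDl ler_pM2r.
have d0 : 0 < (u i t - u i s) * c i by rewrite mulr_gt0 // subr_gt0.
suff : phi s <= phi t - (u i t - u i s) * c i by lra.
apply: phi_le => n; pose m := maxn n i.+1.
have im : (i < m)%N by rewrite leq_maxr.
apply: le_trans (S_mono _ _ _ (leq_maxl n i.+1)) _; rewrite -/m.
suff : S m s + (u i t - u i s) * c i <= S m t by have := Sphi m t; lra.
rewrite /S (bigD1 (Ordinal im)) //= (bigD1 (Ordinal im) (F := fun i => u i t * c i)) //=.
have : \sum_(j < m | j != Ordinal im) u j s * c j <=
       \sum_(j < m | j != Ordinal im) u j t * c j.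
  by apply: ler_sum => j _; rewrite ler_pM2r.
by lra.
Qed.

End WeightedSup.

Section ArcOfWeakArc.
Context {R : realType} {X : metricType R}.
Hypothesis cX : compact [set: X].
Implicit Types (x y z : X) (r s t u v : R).

Lemma within_realP (a : R -> X) (l r : R) : {within `[l, r], continuous a} ->
  forall u (e : R), l <= u <= r -> 0 < e -> exists2 d : R, 0 < d &
    forall v, l <= v <= r -> `|u - v| < d -> mdist (a u) (a v) < e.
Proof.
move=> /subspace_continuousP ca u e ur e0.
have := ca u _ _ (mdist_nbhs (a u) e0); rewrite /= in_itv => /(_ ur).
move=> /nbhs_ballP[d /= d0 dP]; exists d => // v vr uv.
by apply: dP => //; rewrite /= in_itv.
Qed.

Lemma continuous_clamp (a : R -> X) : {within `[0, 1], continuous a} ->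
  continuous (fun t => a (Num.max 0 (Num.min 1 t))).
Proof.
move=> ca; apply/continuous_realP => t e e0.
have clamp01 u : 0 <= Num.max 0 (Num.min 1 u) <= 1.
  by rewrite le_max lexx ge_max ler01 ge_min lexx.
have [d d0 dP] := within_realP ca (clamp01 t) e0; exists d => // s ts.
apply: dP => //; apply: le_lt_trans ts.
have lip (f : R -> R -> R) : f = Num.max \/ f = Num.min -> forall c u v, `|f c u - f c v| <= `|u - v|.
  have n0 (z : R) : 0 <= `|z| by exact: normr_ge0.
  case=> -> c u v.
    by case: (leP c u) => cu; case: (leP c v) => cv //; rewrite ?subrr ?normr0 // ler_norml;
      have := ler_norm (u - v); have := ler_norm (v - u); rewrite (distrC v); lra.
  by case: (leP c u) => cu; case: (leP c v) => cv //; rewrite ?subrr ?normr0 // ler_norml;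
    have := ler_norm (u - v); have := ler_norm (v - u); rewrite (distrC v); lra.
by apply: le_trans (lip Num.max (or_introl erefl) _ _ _) _; apply: lip; right.
Qed.

(* The fibers of [w] are intervals. They are collapsed by reparametrizing with
   [psi], which is built from the distances of a dense sequence [x i] to the
   initial pieces [w @` ]-oo, t]]: these decrease with [t], and one of them drops
   strictly whenever [w] moves. *)
Lemma arc_of_weak_arc (w : R -> X) : continuous w ->
  (forall t, t <= 0 -> w t = w 0) ->
  (forall s r t, s <= r -> r <= t -> w s = w t -> w r = w s) -> w 0 <> w 1 ->
  exists a : R -> X, [/\ continuous a, a 0 = w 0 /\ a 1 = w 1,
    forall t, exists s, a t = w s &
    forall s t, 0 <= s <= 1 -> 0 <= t <= 1 -> a s = a t -> s = t].
Proof.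
move=> cw w0 wW w01.
(* The values of [w] at rational times; natural numbers that code no rational default to time 0. *)
pose x (i : nat) := w (ratr (odflt 0%Q (unpickle i))).
have x_dense t (e : R) : 0 < e -> exists i, mdist (w t) (x i) < e.
  move=> e0; have [d d0 dP] := (continuous_realP w).1 cw t e e0.
  have /rat_in_itvoo[q] : t < t + d by rewrite ltrDl.
  rewrite in_itv /= => /andP[tq qt]; exists (pickle q); rewrite /x pickleK /=.
  by apply: dP; rewrite ltr_norml; lra.
pose D y t := inf [set mdist y (w s) | s in [set s | s <= t]].
have infD y t : has_inf [set mdist y (w s) | s in [set s | s <= t]].
  split; first by exists (mdist y (w t)), t => /=.
  by exists 0 => _ [s _ <-]; exact: mdist_ge0.
have D_le y t s : s <= t -> D y t <= mdist y (w s).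
  by move=> st; apply: ge_inf; [case: (infD y t)|exists s].
have le_D y t c : (forall s, s <= t -> c <= mdist y (w s)) -> c <= D y t.
  by move=> H; apply: lb_le_inf; [case: (infD y t)|move=> _ [s st <-]; exact: H].
have [M M0 MP] := compact_mdist_bounded cX.
have [|phi [phi_le phi_lt]] := @weighted_sup R R (fun i t => D (x i) t) M.
  move=> i t; apply/andP; split; first by apply: le_D => s _; exact: mdist_ge0.
  by apply: le_trans (D_le _ _ _ (lexx t)) _; exact/ltW.
have D_anti y s t : s <= t -> D y t <= D y s.
  by move=> st; apply: le_D => r rs; apply: D_le; exact: le_trans st.
have D_near y s t (e : R) : s <= t -> 0 <= e ->
    (forall r, s <= r <= t -> mdist (w r) (w s) <= e) -> D y s <= D y t + e.
  move=> st e0 H; suff : D y s - e <= D y t by lra.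
  apply: le_D => r rt; have [rs|sr] := leP r s.
    by have := D_le y s r rs; lra.
  have := metric_triangle y (w r) (w s); have := D_le y s s (lexx s).
  by have := H r; rewrite (ltW sr) rt => /(_ isT); lra.
have phi_anti s t : s <= t -> phi t <= phi s.
  move=> st; rewrite -[leRHS]addr0; apply: phi_le => // i.
  by rewrite addr0; exact: D_anti.
have phi_near s t (e : R) : s <= t -> 0 <= e ->
    (forall r, s <= r <= t -> mdist (w r) (w s) <= e) -> phi s <= phi t + e.
  by move=> st e0 H; apply: phi_le => // i; exact: D_near.
(* The initial piece up to [s] is compact and misses [w t], since fibers are intervals. A dense
   point close enough to [w t] is then nearer to the piece up to [t] than to the piece up to [s]. *)
have phi_strict s t : 0 <= s -> s < t -> w s <> w t -> phi t < phi s.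
  move=> s0 st wst; pose I := w @` `[0, s].
  have cI : closed I.
    apply: compact_closed; first exact: metric_hausdorff.
    by apply: continuous_compact; [exact: continuous_subspaceT|exact: segment_compact].
  have Iw r : r <= s -> I (w r).
    move=> rs; have [r0|r0] := leP r 0.
      by exists 0; [rewrite /= in_itv /= lexx s0|rewrite (w0 _ r0)].
    by exists r => //=; rewrite in_itv /= (ltW r0).
  have nIt : ~ I (w t).
    move=> [r]; rewrite /= in_itv /= => /andP[r0 rs] rt; apply: wst.
    by rewrite -rt; exact: (wW r s t rs (ltW st) rt).
  have [d d0 dP] := open_mdistP (closed_openC cI) nIt.
  have d20 : 0 < d / 2 by rewrite divr_gt0.
  have [i ti] := x_dense t _ d20.
  apply: (phi_lt _ _ i) => [j|]; first by apply: D_anti; exact: ltW.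
  apply: (@le_lt_trans _ _ (mdist (x i) (w t))); first exact: D_le.
  apply: (@lt_le_trans _ _ (d / 2)); first by rewrite metric_sym.
  apply: le_D => r rs; have := metric_triangle (w t) (x i) (w r).
  suff : d <= mdist (w t) (w r) by lra.
  by rewrite leNgt; apply/negP => /dP; apply; exact: Iw.
have cphi : continuous phi.
  move=> t U /nbhs_ballP[e /= e0 eU]; have e20 : 0 < e / 3 by rewrite divr_gt0.
  have [d d0 dP] := (continuous_realP w).1 cw t _ e20.
  apply/nbhs_ballP; exists d => //= s ts; apply: eU; rewrite /ball /=.
  have osc a b : a <= b -> a <= t <= b -> `|t - a| < d -> `|t - b| < d -> phi a <= phi b + (e / 3 + e / 3).
    move=> ab atb ta tb; apply: phi_near => //; first lra.
    move=> r arb; have : mdist (w t) (w r) < e / 3 by apply: dP; move: ta tb; rewrite !ltr_norml; lra.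
    have : mdist (w t) (w a) < e / 3 by exact: dP.
    by have := metric_triangle (w r) (w t) (w a); rewrite (metric_sym (w r) (w t)); lra.
  have [st|ts'] := leP s t.
    have := osc s t st; rewrite st lexx subrr normr0 => /(_ isT ts d0).
    by have := phi_anti _ _ st; rewrite ltr_norml; lra.
  have := osc t s (ltW ts'); rewrite (ltW ts') lexx subrr normr0 => /(_ isT d0 ts).
  by have := phi_anti _ _ (ltW ts'); rewrite ltr_norml; lra.
have p01 : 0 < phi 0 - phi 1 by rewrite subr_gt0; exact: phi_strict.
pose psi t := (phi 0 - phi t) / (phi 0 - phi 1).
have psiE s t : psi s = psi t -> phi s = phi t.
  by move=> /mulIf; rewrite invr_eq0 gt_eqF // => /(_ isT); lra.
have cpsi : continuous psi.
  move=> t; apply: cvgM; last exact: cvg_cst.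
  by apply: cvgB; [exact: cvg_cst|exact: cphi].
have psi0 : psi 0 = 0 by rewrite /psi subrr mul0r.
have psi1 : psi 1 = 1 by rewrite /psi divff // gt_eqF.
have psi_w s t : 0 <= s <= 1 -> 0 <= t <= 1 -> psi s = psi t -> w s = w t.
  wlog st : s t / s <= t.
    move=> H s01 t01 E; have [st|ts] := leP s t; first exact: H.
    by apply/esym/H => //; exact: ltW.
  move=> /andP[s0 _] t01 /psiE E; apply: contrapT => wst.
  have : s < t by rewrite lt_neqAle st andbT; apply/eqP => st'; apply: wst; rewrite st'.
  by move=> /(phi_strict _ _ s0)/(_ wst); rewrite E ltxx.
have w_psi s t : w s = w t -> psi s = psi t.
  wlog st : s t / s <= t.
    move=> H E; have [st|ts] := leP s t; first exact: H.
    by apply/esym/H => //; exact: ltW.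
  move=> E; congr (_ / _); congr (_ - _); apply/eqP; rewrite eq_le (phi_anti _ _ st) andbT.
  rewrite -[leRHS]addr0; apply: phi_near => // r /andP[sr rt].
  by rewrite (wW _ _ _ sr rt E) mdistxx.
have psi_onto u : 0 <= u <= 1 -> exists2 t, 0 <= t <= 1 & psi t = u.
  move=> u01; have [||t] := @IVT R psi 0 1 u ler01.
  - exact: continuous_subspaceT.
  - by rewrite psi0 psi1 minEle maxEle ler01.
  by rewrite in_itv /= => t01 <-; exists t.
have psi01 t : 0 <= t <= 1 -> 0 <= psi t <= 1.
  move=> /andP[t0 t1]; rewrite divr_ge0 ?subr_ge0 ?phi_anti //=.
  by rewrite ler_pdivrMr // mul1r lerD2l lerN2 phi_anti.
have in01 t : [set` `[0, 1]] t <-> 0 <= t <= 1 by rewrite /= in_itv.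
have [|||||s t|a [aE ca]] := @factor_continuous R R X [set` `[0, 1]] psi w.
- exact: segment_compact.
- exact: Rhausdorff.
- by exists 0; apply/in01; rewrite lexx ler01.
- exact: continuous_subspaceT.
- exact: continuous_subspaceT.
- by move=> /in01 s01 /in01 t01; exact: psi_w.
have imE : psi @` [set` `[0, 1]] = [set` `[0, 1]].
  apply/seteqP; split=> [_ [t /in01 t01 <-]|u /in01 /psi_onto[t t01 <-]].
    by apply/in01; exact: psi01.
  by exists t => //; apply/in01.
rewrite imE in ca; pose clamp t : R := Num.max 0 (Num.min 1 t).
have clamp01 t : 0 <= clamp t <= 1.
  by rewrite le_max lexx ge_max ler01 ge_min lexx.
have clamp_id t : 0 <= t <= 1 -> clamp t = t.
  by move=> /andP[t0 t1]; rewrite /clamp (min_idPr t1) (max_idPr t0).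
have {}aE t : 0 <= t <= 1 -> a (psi t) = w t by move=> t01; apply: aE; apply/in01.
exists (a \o clamp); split=> /=.
- exact: continuous_clamp.
- rewrite !clamp_id ?lexx ?ler01 //; split.
    by rewrite -[in LHS]psi0 aE // lexx ler01.
  by rewrite -[in LHS]psi1 aE // lexx ler01.
- move=> t; have [s s01 <-] := psi_onto _ (clamp01 t).
  by exists s; exact: aE.
move=> s t s01 t01; rewrite !clamp_id //.
have [s' s'01 <-] := psi_onto _ s01; have [t' t'01 <-] := psi_onto _ t01.
by rewrite !aE // => /w_psi.
Qed.

End ArcOfWeakArc.

(** * Unique arcs in dendrites *)

Section UniqueArcs.
Context {R : realType} {X : metricType R}.
Implicit Types (al be : R -> X) (r s t u v : R).

Definition injective01 al := forall s t, 0 <= s <= 1 -> 0 <= t <= 1 ->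
  al s = al t -> s = t.

Lemma unit_circle_compact : compact (@unit_circle R).
Proof.
apply: (@subclosed_compact (R * R)%type _ ([set` `[-1, 1]] `*` [set` `[-1, 1]])).
- rewrite (_ : unit_circle = (fun z : R * R => z.1 ^+ 2 + z.2 ^+ 2) @^-1` [set 1]) //.
  apply: closed_comp; last exact: closed_eq.
  move=> z _; apply: cvgD; apply: cvgM; [exact: cvg_fst|exact: cvg_fst|exact: cvg_snd|exact: cvg_snd].
- by apply: compact_setX; exact: segment_compact.
move=> [x y] /= xy; rewrite /= !in_itv /=.
have h (z w : R) : z ^+ 2 + w ^+ 2 = 1 -> -1 <= z <= 1.
  by move=> zw; apply/andP; split; nra.
by split; [exact: h xy|apply: (h y x); rewrite addrC].
Qed.

(** The upper half circle runs along [al] and the lower one along [be], both with parameter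
    [(z.1 + 1) / 2]. The continuous inverse comes from [factor_continuous] with the identity in the
    role of [k]. *)
Lemma theta_curve al be : continuous al -> continuous be ->
  injective01 al -> injective01 be -> al 0 = be 0 -> al 1 = be 1 ->
  (forall u v, 0 <= u <= 1 -> 0 <= v <= 1 -> al u = be v ->
     u = 0 /\ v = 0 \/ u = 1 /\ v = 1) ->
  exists S : set X, simple_closed_curve S.
Proof.
move=> ca cb ia ib e0 e1 cross.
pose p (z : R * R) := 1 / 2 * z.1 + 1 / 2.
pose g (z : R * R) := if 0 <= z.2 then al (p z) else be (p z).
have p01 z : unit_circle z -> 0 <= p z <= 1.
  by rewrite /unit_circle /p /= => H; apply/andP; split; nra.
have edge z : unit_circle z -> z.2 = 0 -> p z = 0 \/ p z = 1.
  rewrite /unit_circle /p /= => H z0; rewrite z0 in H.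
  have : (z.1 - 1) * (z.1 + 1) = 0 by lra.
  by move=> /eqP; rewrite mulf_eq0 => /orP[] /eqP h; [right|left]; lra.
have g_lower z : unit_circle z -> z.2 <= 0 -> g z = be (p z).
  move=> Cz z0; rewrite /g; case: ifP => // z0'.
  have /(edge _ Cz)[->|->] : z.2 = 0 by lra.
    exact: e0.
  exact: e1.
have g_upper z : 0 <= z.2 -> g z = al (p z) by move=> z0; rewrite /g z0.
have cp (k : R -> X) : continuous k -> continuous (k \o p).
  move=> ck z; apply: continuous_comp; last exact: ck.
  apply: cvgD; last exact: cvg_cst.
  by apply: cvgM; [exact: cvg_cst|exact: cvg_fst].
have cg : {within unit_circle, continuous g}.
  pose Cp : set (R * R) := unit_circle `&` [set z | 0 <= z.2].
  pose Cm : set (R * R) := unit_circle `&` [set z | z.2 <= 0].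
  have cC : closed (@unit_circle R).
    by apply: compact_closed; [exact: norm_hausdorff|exact: unit_circle_compact].
  have -> : unit_circle = Cp `|` Cm.
    apply/seteqP; split=> [z Cz|z [[]|[]]//].
    by have [z0|z0] := leP 0 z.2; [left|right; split=> //; exact: ltW].
  apply: withinU_continuous.
  - apply: closedI => //; apply: (@closed_comp _ _ snd [set r : R | 0 <= r]) => [z _|].
      exact: cvg_snd.
    exact: closed_ge.
  - apply: closedI => //; apply: (@closed_comp _ _ snd [set r : R | r <= 0]) => [z _|].
      exact: cvg_snd.
    exact: closed_le.
  - apply: (@subspace_eq_continuous _ _ _ (al \o p)).
      by move=> z /set_mem[_ z0]; exact/esym/g_upper.
    by apply: continuous_subspaceT; exact: cp.
  - apply: (@subspace_eq_continuous _ _ _ (be \o p)).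
      by move=> z /set_mem[Cz z0]; exact/esym/g_lower.
    by apply: continuous_subspaceT; exact: cp.
have p_inj z z' : unit_circle z -> unit_circle z' -> p z = p z' ->
    0 <= z.2 * z'.2 -> z = z'.
  case: z z' => [x y] [x' y']; rewrite /unit_circle /p /= => H H' xx yy.
  have {}xx : x = x' by lra.
  rewrite xx in H *; congr pair.
  have : (y - y') * (y + y') = 0 by lra.
  by move=> /eqP; rewrite mulf_eq0 => /orP[] /eqP h; nra.
have mixed z z' : unit_circle z -> unit_circle z' -> 0 <= z.2 -> z'.2 < 0 ->
    g z = g z' -> False.
  move=> Cz Cz' z0 z'0; rewrite g_upper // g_lower ?ltW // => E.
  have sq1 : z'.1 ^+ 2 = 1.
    have [[_]|[_]] := cross _ _ (p01 _ Cz) (p01 _ Cz') E; rewrite /p => h.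
      have -> : z'.1 = -1 by lra.
      by rewrite sqrrN expr1n.
    have -> : z'.1 = 1 by lra.
    by rewrite expr1n.
  have /eqP : z'.2 ^+ 2 = 0 by move: Cz'; rewrite /unit_circle /=; lra.
  by rewrite sqrf_eq0 lt_eqF.
have g_inj z z' : unit_circle z -> unit_circle z' -> g z = g z' -> z = z'.
  move=> Cz Cz'; have [z0|z0] := leP 0 z.2; have [z'0|z'0] := leP 0 z'.2.
  - rewrite !g_upper // => /ia E; apply: p_inj => //; first by apply: E; exact: p01.
    exact: mulr_ge0.
  - by move=> /(mixed _ _ Cz Cz' z0 z'0).
  - by move=> /esym/(mixed _ _ Cz' Cz z'0 z0).
  - rewrite !g_lower ?ltW // => /ib E; apply: p_inj => //; first by apply: E; exact: p01.
    by rewrite nmulr_lge0 // ltW.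
have [|||||z z'|h [hg ch]] := @factor_continuous _ _ _ unit_circle g (@id (R * R)).
- exact: unit_circle_compact.
- exact: metric_hausdorff.
- by exists (1, 0); rewrite /unit_circle /= expr1n expr0n addr0.
- exact: cg.
- by apply: continuous_subspaceT => z; exact: cvg_id.
- exact: g_inj.
exists (g @` unit_circle), g, h; split=> //.
- split; first by move=> z Cz; exists z.
  by move=> _ [z Cz <-]; rewrite hg.
- by move=> _ [z Cz <-]; rewrite hg.
Qed.

(** If [al s] is off [be], let [a] and [b] be the last time before and the first time after [s] at
    which [al] is on [be]. The excursion of [al] between them and the piece of [be] with the same
    ends form a circle. The parameters [ra], [rb] may come in either order; the affine
    reparametrization handles both. *)
Lemma arc_sub al be : ~ (exists S : set X, simple_closed_curve S) ->
  continuous al -> continuous be -> injective01 al -> injective01 be ->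
  al 0 = be 0 -> al 1 = be 1 -> al @` `[0, 1] `<=` be @` `[0, 1].
Proof.
move=> nS ca cb ia ib e0 e1 _ [s s01 <-].
rewrite /= in_itv /= in s01; have /andP[s0 s1] := s01.
apply: contrapT => ns; apply: nS.
pose C := al @^-1` (be @` `[0, 1]).
have memb r : 0 <= r <= 1 -> (be @` `[0, 1]) (be r) by move=> r01; exists r => //=; rewrite in_itv.
have cC : closed C.
  apply: closed_comp => [? _|]; first exact: ca.
  apply: compact_closed; first exact: metric_hausdorff.
  by apply: continuous_compact; [exact: continuous_subspaceT|exact: segment_compact].
have [|a [a0 as_ [ra ra01 Ea] aP]] := last_before cC _ s0.
  by rewrite /C /= e0; apply: memb; rewrite lexx ler01.
have [|b [sb b1 [rb rb01 Eb] bP]] := first_after cC _ s1.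
  by rewrite /C /= e1; apply: memb; rewrite lexx ler01.
rewrite /= in_itv /= in ra01; rewrite /= in_itv /= in rb01.
have as' : a < s.
  rewrite lt_neqAle as_ andbT; apply/eqP => E; apply: ns; rewrite -E -Ea.
  exact: memb.
have sb' : s < b.
  rewrite lt_neqAle sb andbT; apply/eqP => E; apply: ns; rewrite E -Eb.
  exact: memb.
have rab : rb - ra != 0.
  apply/eqP => E; have Er : rb = ra by lra.
  have : a = b by apply: ia; [lra|lra|rewrite -Ea -Eb Er].
  by lra.
have conv (x y u : R) : 0 <= x <= 1 -> 0 <= y <= 1 -> 0 <= u <= 1 -> 0 <= (y - x) * u + x <= 1.
  by move=> /andP[x0 x1] /andP[y0 y1] /andP[u0 u1]; apply/andP; split; nra.
have a01 : 0 <= a <= 1 by lra.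
have b01 : 0 <= b <= 1 by lra.
apply: (@theta_curve (fun u => al ((b - a) * u + a)) (fun u => be ((rb - ra) * u + ra))).
- exact: continuous_affine.
- exact: continuous_affine.
- move=> u v u01 v01 /ia E.
  have : (b - a) * u + a = (b - a) * v + a by apply: E; exact: conv.
  by move=> /addIr/mulfI; apply; rewrite subr_eq0 gt_eqF // (lt_trans as').
- move=> u v u01 v01 /ib E.
  have : (rb - ra) * u + ra = (rb - ra) * v + ra by apply: E; exact: conv.
  by move=> /addIr/mulfI; apply.
- by rewrite !mulr0 !add0r.
- by rewrite !mulr1 !subrK.
move=> u v u01 v01 E; have /andP[u0 u1] := u01.
have Cu : C ((b - a) * u + a) by rewrite /C /= E; apply: memb; exact: conv.
have [us|su] := leP ((b - a) * u + a) s.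
  have u0' : u = 0.
    apply/eqP; rewrite eq_le u0 andbT leNgt; apply/negP => u0'.
    by apply: (aP _ _ us) => //; rewrite ltrDr mulr_gt0 // subr_gt0; lra.
  left; split=> //; rewrite u0' mulr0 add0r -Ea in E.
  have : ra = (rb - ra) * v + ra by apply: ib => //; exact: conv.
  move=> Ev; have /eqP : (rb - ra) * v = 0 by lra.
  by rewrite mulf_eq0 (negbTE rab) => /eqP.
have u1' : u = 1.
  apply/eqP; rewrite eq_le u1 /= leNgt; apply/negP => u1'.
  apply: (bP _ (ltW su)) => //; nra.
right; split=> //; rewrite u1' mulr1 subrK -Eb in E.
have : rb = (rb - ra) * v + ra by apply: ib => //; exact: conv.
move=> Ev; have /eqP : (rb - ra) * (v - 1) = 0 by lra.
by rewrite mulf_eq0 (negbTE rab) subr_eq0 => /eqP.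
Qed.

End UniqueArcs.

Section Segments.
Context {R : realType} {X : metricType R}.
Hypothesis dX : dendrite [set: X].
Implicit Types (U C : set X) (a b p : X).

Definition seg a b : set X :=
  [set z | forall C, connected C -> C a -> C b -> C z].

Lemma arc_exists U a b : open U -> connected U -> U a -> U b -> a <> b ->
  exists al : R -> X, [/\ continuous al, al 0 = a /\ al 1 = b,
    forall t, U (al t) & injective01 al].
Proof.
move=> oU cU Ua Ub ab; have [[_ cX _] lcX _] := dX.
have [g [cg g0 g1 gU]] := open_connected_joined cX lcX oU cU Ua Ub.
have [w [cw [w0 w1] wg wc wW]] := weak_arc cg.
have [|al [ca [a0 a1] alw ia]] := arc_of_weak_arc cX cw wc wW.
  by rewrite w0 w1 g0 g1.
exists al; split=> //; first by rewrite a0 a1 w0 w1.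
by move=> t; have [s ->] := alw t; have [r ->] := wg s.
Qed.

Lemma component_avoid_open a p : open (connected_component (~` [set p]) a).
Proof.
apply: open_mdist => z zc; apply: nbhs_mdist; have [_ lcX _] := dX.
have oP : open (~` [set p] : set X).
  by apply: closed_openC; exact: closed_point.
have Pz : (~` [set p]) z by exact: connected_component_sub zc.
have [V [oV Vz]] := lcX z _ I oP Pz; rewrite setTI => cV VP.
apply: filterS (open_nbhs_nbhs (conj oV Vz)) => y Vy.
apply: connected_component_trans zc _; exact: (connected_component_max Vz VP cV).
Qed.

(** A connected set containing [a] and [b] but missing [z] lies in one component of the complement
    of [z]. That component is open, so it contains an arc from [a] to [b], and uniqueness of arcs
    puts [z] on it. *)
Lemma seg_arc a b : a <> b -> exists2 al : R -> X, continuous al &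
  seg a b = al @` `[0, 1].
Proof.
move=> ab; have [[_ _ conX] _ nS'] := dX.
have nS : ~ (exists S : set X, simple_closed_curve S).
  by move=> [S SC]; apply: nS'; exists S.
have [al [ca [a0 a1] _ ia]] := arc_exists openT conX I I ab.
exists al => //; apply/seteqP; split.
  move=> z; apply; last 2 first.
  - by exists 0 => //=; rewrite in_itv /= lexx ler01.
  - by exists 1 => //=; rewrite in_itv /= lexx ler01.
  apply: connected_continuous_connected; first exact: segment_connected.
  exact: continuous_subspaceT.
move=> z zal C cC Ca Cb; apply: contrapT => nCz.
pose U := connected_component (~` [set z]) a.
have CU : C `<=` U by apply: connected_component_max => // y Cy yz; apply: nCz; rewrite -yz.
have [be [cb [b0 b1] beU ib]] := arc_exists (@component_avoid_open a z)
  (@component_connected _ _ _) (CU _ Ca) (CU _ Cb) ab.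
have [||t _ tz] := arc_sub nS ca cb ia ib _ _ zal; [by rewrite a0 b0|by rewrite a1 b1|].
by have := connected_component_sub (beU t); rewrite tz; apply.
Qed.

Lemma seg_connected a b : connected (seg a b).
Proof.
have [<-|ab] := pselect (a = b).
  rewrite (_ : seg a a = [set a]); first exact: connected1.
  by apply/seteqP; split=> [z /(_ _ (@connected1 _ a))|_ ->]; [apply|].
have [al ca ->] := seg_arc ab.
apply: connected_continuous_connected; first exact: segment_connected.
exact: continuous_subspaceT.
Qed.

Lemma seg_closed a b : closed (seg a b).
Proof.
have [<-|ab] := pselect (a = b).
  rewrite (_ : seg a a = [set a]).
    exact: closed_point.
  by apply/seteqP; split=> [z /(_ _ (@connected1 _ a))|_ ->]; [apply|].
have [al ca ->] := seg_arc ab.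
apply: compact_closed; first exact: metric_hausdorff.
by apply: continuous_compact; [exact: continuous_subspaceT|exact: segment_compact].
Qed.

End Segments.

Arguments seg_connected {R X} dX a b.
Arguments seg_closed {R X} dX a b.

Section AsymptoticRegularity.
Context {R : realType}.

Definition asymptotically_regular {Z : metricType R} (F : Z -> Z) z :=
  forall e : R, 0 < e -> exists N M, (0 < N)%N /\
    forall m k, (M <= m)%N -> mdist (iter m F z) (iter (m + k * N) F z) < e.

(** [N] is the least positive difference of two members of [V], attained at [l0]. A later member not
    congruent to [l0] modulo [N] would form a smaller difference with the progression from [l0]. If
    no two members exist, [V] is eventually empty. *)
Lemma eventually_progression (V : nat -> Prop) :
  (forall l d k, V l -> V (l + d)%N -> V (l + k * d)%N) ->
  exists N M, (0 < N)%N /\ forall l k, (M <= l)%N -> V l <-> V (l + k * N)%N.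
Proof.
move=> Vk.
pose P d := (0 < d)%N && `[< exists l, V l /\ V (l + d)%N >].
have [exP|nP] := pselect (exists d, P d); last first.
  have V1 l l' : V l -> V l' -> (l < l')%N -> False.
    move=> Vl Vl' ll'; apply: nP; exists (l' - l)%N; rewrite /P subn_gt0 ll' /=.
    by apply/asboolP; exists l; rewrite subnKC // ltnW.
  have [[l0 Vl0]|nV] := pselect (exists l, V l); last first.
    by exists 1%N, 0%N; split=> // l k _; split=> H; exfalso; apply: nV; [exists l|exists (l + k * 1)%N].
  exists 1%N, l0.+1; split=> // l k l0l; split=> H; exfalso; apply: V1 Vl0 H _ => //.
  by apply: leq_trans l0l _; exact: leq_addr.
case: (ex_minnP exP) => N /andP[N0 /asboolP[l0 [Vl0 VN]]] minN.
have VE l : (l0 <= l)%N -> V l <-> (N %| l - l0)%N.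
  move=> l0l; split=> [Vl|/dvdnP[k kE]]; last first.
    by rewrite -(subnKC l0l) kE; exact: Vk.
  rewrite /dvdn eqn0Ngt; apply/negP => r0.
  suff /minN : P ((l - l0) %% N)%N by rewrite leqNgt ltn_pmod.
  rewrite /P r0 /=; apply/asboolP; exists (l0 + (l - l0) %/ N * N)%N.
  by split; [exact: Vk|rewrite -addnA -divn_eq subnKC].
exists N, l0; split=> // l k l0l.
rewrite !VE ?(leq_trans l0l) ?leq_addr // -addnBAC // dvdn_addl //.
exact: dvdn_mull.
Qed.

End AsymptoticRegularity.

(** * The order of a rooted dendrite *)

Section DendriteOrder.
Context {R : realType} {X : metricType R}.
Hypothesis dX : dendrite [set: X].
Implicit Types (A C U : set X) (a b c p q x y z t m w : X).

Let segc a b : connected (seg a b). Proof. exact: seg_connected. Qed.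
Arguments segc : clear implicits.

Lemma dendrite_setT_compact : compact [set: X].
Proof. exact: dendrite_compact dX. Qed.

Lemma dendrite_setT_connected : connected [set: X].
Proof. by case: dX => -[]. Qed.

Lemma connected_nbhs x U : nbhs x U ->
  exists V, [/\ open V, V x, connected V & V `<=` U].
Proof.
rewrite nbhsE => -[W [oW Wx] WU]; case: dX => _ lc _.
have [V [oV Vx cV VW]] := lc x W I oW Wx; exists V.
by move: cV VW; rewrite setTI => cV VW; split=> //; exact: subset_trans WU.
Qed.

Lemma seg_min C a b : connected C -> C a -> C b -> seg a b `<=` C.
Proof. by move=> cC Ca Cb z; exact. Qed.

Lemma segl a b : seg a b a. Proof. by []. Qed.

Lemma segr a b : seg a b b. Proof. by []. Qed.

Lemma segC a b : seg a b = seg b a.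
Proof. by apply/seteqP; split=> z H C *; exact: H. Qed.

Arguments segl : clear implicits.
Arguments segr : clear implicits.

Lemma seg_refl a z : seg a a z -> z = a.
Proof. by move=> /(_ [set a]); apply => //; exact: connected1. Qed.

Lemma seg_split b a c z : seg a c z -> seg a b z \/ seg b c z.
Proof.
move=> /(_ (seg a b `|` seg b c)); apply.
- by apply: connectedU; [exists b; split; [exact: segr|exact: segl]| |].
- by left; exact: segl.
- by right; exact: segr.
Qed.

Lemma seg_sub a b x y : seg a b x -> seg a b y -> seg x y `<=` seg a b.
Proof. by move=> ax ay; exact: seg_min. Qed.

(** In the order rooted at [a], [seg a z p] reads [p <= z]. Moving [z] inside a connected
    neighbourhood that misses [p] cannot change whether this holds; the same argument gives
    [above_open]. *)
Lemma avoid_open a p : open [set z | ~ seg a z p].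
Proof.
apply: open_mdist => z nz; apply: nbhs_mdist.
have zp : z <> p by move=> zp; apply: nz; rewrite zp.
have [V [oV Vz cV Vp]] := connected_nbhs (open_nbhs_nbhs (conj (closed_openC (@closed_point _ _ p)) zp)).
apply: filterS (open_nbhs_nbhs (conj oV Vz)) => y Vy /= /(seg_split z)[//|zyp].
by apply: (Vp _ (seg_min cV Vz Vy zyp)).
Qed.

Lemma above_closed a p : closed [set z | seg a z p].
Proof.
by rewrite -openC; apply: avoid_open.
Qed.

Lemma above_open a p : open [set z | seg a z p /\ z <> p].
Proof.
apply: open_mdist => z [az zp]; apply: nbhs_mdist.
have [V [oV Vz cV Vp]] := connected_nbhs (open_nbhs_nbhs (conj (closed_openC (@closed_point _ _ p)) zp)).
apply: filterS (open_nbhs_nbhs (conj oV Vz)) => y Vy /=; split; last first.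
  by move=> yp; apply: (Vp y).
have [//|yzp] := seg_split y az.
by case: (Vp _ (seg_min cV Vy Vz yzp)).
Qed.

Lemma avoid_connected a p : connected [set z | ~ seg a z p].
Proof.
have [->|ap] := pselect (a = p).
  rewrite (_ : [set _ | _] = set0); first exact: connected0.
  by apply/seteqP; split=> // z /= /(_ (segl _ _)).
rewrite (_ : [set _ | _] = \bigcup_(z in [set z | ~ seg a z p]) seg a z).
  apply: bigcup_connected => //.
  by exists a => z _; exact: segl.
apply/seteqP; split=> [z nz|z [y /= ny yz]]; first by exists z.
by move=> zp; apply: ny; exact: (seg_sub (segl a y) yz).
Qed.

(** The point [p] is in the closure of the points not above it; otherwise these and the remaining
    points would disconnect [X]. Antisymmetry of the order rests on this set: it contains the root
    and [p], but nothing strictly above [p]. *)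
Lemma avoid_connectedU a p : a <> p -> connected ([set z | ~ seg a z p] `|` [set p]).
Proof.
move=> ap; apply: (@connected_between _ [set z | ~ seg a z p]).
- exact: avoid_connected.
- by move=> z; left.
move=> z [nz|->]; first exact: subset_closure.
apply: contrapT => ncl.
suff [x [_ nx []]] : exists x, [/\ [set: X] x, ~ seg a x p &
    ((seg a x p /\ x <> p) \/ ~ closure [set z | ~ seg a z p] x)].
  - by move=> [].
  - by apply; exact: subset_closure.
apply: (@connected_meet_open _ setT [set z | ~ seg a z p]
   ([set z | seg a z p /\ z <> p] `|` ~` closure [set z | ~ seg a z p]) a p) => //.
- exact: dendrite_setT_connected.
- exact: avoid_open.
- by apply: openU; [exact: above_open|apply: closed_openC; exact: closed_closure].
- move=> x _; have [ax|nx] := pselect (seg a x p); last by left.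
  have [->|xp] := pselect (x = p); first by right; right.
  by right; left.
- by move=> /seg_refl pa; apply: ap.
- by right.
Qed.

Lemma seg_antisym a x y : seg a y x -> seg a x y -> x = y.
Proof.
move=> ayx axy; apply: contrapT => xy.
have [ax|ax] := pselect (a = x); first by apply: xy; rewrite -ax in axy *; rewrite (seg_refl axy).
have [|yx] : ([set z | ~ seg a z x] `|` [set x]) y; last exact: xy.
  apply: (seg_min (avoid_connectedU ax) _ _ axy); last by right.
  by left=> /= /seg_refl xa; exact: ax.
by apply.
Qed.

Lemma seg_trans a x y z : seg a y x -> seg a z y -> seg a z x.
Proof. by move=> ayx azy; apply: seg_sub ayx => //; exact: segl. Qed.

Lemma seg_between a x y z : seg a y x -> seg a z y -> seg x z y.
Proof.
move=> ayx azy; have [axy|//] := seg_split x azy.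
by rewrite (seg_antisym ayx axy).
Qed.

Lemma seg_total a b x y : seg a b x -> seg a b y -> seg a y x \/ seg a x y.
Proof.
move=> abx aby; have [|ybx] := seg_split y abx; first by left.
have [|xby] := seg_split x aby; first by right.
have -> : x = y by apply: (@seg_antisym b); rewrite segC.
by left; exact: segr.
Qed.

Lemma seg_dense a b : a <> b -> forall e : R, 0 < e ->
  exists t, [/\ seg a b t, t <> a, t <> b & mdist a t < e].
Proof.
move=> ab e e0; have d0 : 0 < mdist a b by rewrite mdist_gt0; apply/eqP.
have m0 : 0 < Num.min e (mdist a b) by rewrite lt_min e0.
have [t [abt ta]] := connected_near (segc a b) (segl a b) (segr a b) ab m0.
rewrite lt_min => /andP[te td]; exists t; split=> // tb.
by rewrite tb ltxx in td.
Qed.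

(** The median of the three points. This form is visibly preserved by a monotone map fixing [p];
    [is_meet_max] shows that it is the greatest lower bound. *)
Definition is_meet p x y m := [/\ seg p x m, seg p y m & seg x y m].

Lemma is_meet_exists p x y : exists m, is_meet p x y m.
Proof.
have cov : seg x y `<=` seg p x `|` seg p y.
  by move=> z /(seg_split p)[|pyz]; [left; rewrite segC|right].
have [m [xym pxm pym]] := connected_meet_closed (segc x y) (seg_closed dX p x)
  (seg_closed dX p y) cov (segl x y) (segr p x) (segr x y) (segr p y).
by exists m; split.
Qed.

Lemma is_meet_max p x y m t : is_meet p x y m -> seg p x t -> seg p y t ->
  seg p m t.
Proof.
move=> [pxm pym xym] pxt pyt.
have [//|ptm] := seg_total pxt pxm.
have xt : seg x m t by rewrite segC; exact: seg_between ptm pxt.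
have yt : seg y m t by rewrite segC; exact: seg_between ptm pyt.
suff -> : m = t by exact: segr.
have [xtm|tym] := seg_split t xym; first exact: seg_antisym xtm xt.
by rewrite segC in tym; exact: seg_antisym tym yt.
Qed.

Lemma is_meet_unique p x y m m' : is_meet p x y m -> is_meet p x y m' -> m = m'.
Proof.
move=> mP m'P; apply: (@seg_antisym p).
  by apply: (is_meet_max m'P); case: mP.
by apply: (is_meet_max mP); case: m'P.
Qed.

(** Provides the threshold [t]: being strictly above [t] is an open condition true at [x], and not
    being above [t] is an open condition true at [y]. *)
Lemma not_le_separated p x y : ~ seg p y x -> exists t,
  [/\ seg p x t, x <> t & ~ seg p y t].
Proof.
move=> nyx; have [m mP] := is_meet_exists p x y.
have [pxm pym _] := mP.
have mx : m <> x by move=> mx; apply: nyx; rewrite -mx.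
have [t [mxt tm tx _]] := seg_dense mx (@ltr01 R).
have pxt : seg p x t by apply: (seg_sub pxm (segr p x)).
exists t; split=> //; first by move=> xt; exact: tx.
move=> pyt; apply: tm; have pmt := is_meet_max mP pxt pyt.
apply: (@seg_antisym x); last by rewrite segC; exact: seg_between pmt pxm.
by rewrite segC.
Qed.

Lemma seg_small (e : R) : 0 < e -> exists2 d : R, 0 < d &
  forall x y z, mdist x y < d -> seg x y z -> mdist x z < e.
Proof.
have [_ lc _] := dX; move=> e0.
have [d d0 dP] := uniform_local_connectedness dendrite_setT_compact lc e0.
exists d => // x y z /dP[A [cA Ax Ay Az]] xyz.
by apply: Az; exact: seg_min xyz.
Qed.

Section MonotoneMap.
Variable f : X -> X.
Hypothesis mf : monotone_map f.

(** The preimage of [seg (f a) (f b)] is connected and contains [a] and [b]. *)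
Lemma monotone_seg a b z : seg a b z -> seg (f a) (f b) (f z).
Proof.
by move=> abz; have := abz _ (mf (segc (f a) (f b))); apply; [exact: segl|exact: segr].
Qed.

Lemma monotone_is_meet p x y m : f p = p -> is_meet p x y m ->
  is_meet p (f x) (f y) (f m).
Proof.
by move=> fp [pxm pym xym]; split; last exact: monotone_seg;
  rewrite -{1}fp; exact: monotone_seg.
Qed.

Lemma monotone_map_iter k : monotone_map (iter k f).
Proof.
elim: k => [|k IH] C cC //=.
by have := IH _ (mf cC); rewrite -comp_preimage.
Qed.

End MonotoneMap.

Lemma continuous_iter (f : X -> X) k : continuous f -> continuous (iter k f).
Proof.
move=> cf; elim: k => [|k IH] x /=; first exact: cvg_id.
exact: (continuous_comp (IH x) (cf _)).
Qed.

(** * Orbits whose consecutive meets descend *)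

Section MonotoneOrbit.
Variables (g : X -> X) (p z0 w0 : X).
Hypotheses (cg : continuous g) (mg : monotone_map g) (gp : g p = p).
Hypothesis w0P : is_meet p z0 (g z0) w0.
Hypothesis nw0 : ~ seg p (g w0) w0.

Let z i := iter i g z0.
Let w i := iter i g w0.

Let wP i : is_meet p (z i) (z i.+1) (w i).
Proof. by elim: i => //= i IH; exact: monotone_is_meet. Qed.

Let w_decr i : seg p (w i) (w i.+1).
Proof.
elim: i => [|i IH] /=; last by rewrite -{1}gp; exact: monotone_seg.
have [_ pz w1] := wP 0; have [pz' _ _] := wP 1.
by have [/nw0|] := seg_total pz pz'.
Qed.

Arguments w_decr : clear implicits.

Let w_anti i j : (i <= j)%N -> seg p (w i) (w j).
Proof.
move=> /subnKC <-; elim: (j - i)%N => [|k IH]; first by rewrite addn0; exact: segr.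
by rewrite addnS; exact: seg_trans (w_decr _) IH.
Qed.

Let inf_w q : acc w q -> (forall i, seg p (w i) q) /\
  forall t, (forall i, seg p (w i) t) -> seg p q t.
Proof.
move=> wq; split=> [i|t tw].
  by apply: (acc_closed (seg_closed dX p (w i)) _ wq) => j; exact: w_anti.
by apply: (acc_closed (n := 0%N) (@above_closed p t) _ wq) => i _; exact: tw.
Qed.

(** The limit is the infimum [q] of the descending meets. Every accumulation point [y] of the orbit
    is above [q]; if [y <> q], the orbit is above some [t] with [q < t < y] infinitely often, and
    this is refuted separately when [w] never reaches [q] and when it does. *)
Lemma descending_meet_cvg : exists q, forall e : R, 0 < e ->
  exists n, forall i, (n <= i)%N -> mdist q (z i) < e.
Proof.
have [q wq] := acc_exists w dendrite_setT_compact.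
have [qw qmax] := inf_w wq.
have gq : g q = q.
  have /inf_w[gqw gqmax] : acc w (g q).
    apply: (@acc_shift _ _ _ _ 1); apply: (eq_ind _ (acc^~ _) (acc_continuous cg wq)).
    by apply/funext => i; rewrite addn1.
  by apply: (@seg_antisym p); [exact: qmax|exact: gqmax].
exists q; apply: acc_cvg dendrite_setT_compact _ => y zy.
have qz i : seg p (z i) q by have [zw _ _] := wP i; exact: seg_trans (qw i) zw.
have py : seg p y q.
  by apply: (acc_closed (n := 0%N) (@above_closed p q) _ zy) => i _; exact: qz.
apply: contrapT => yq.
have [t [pyt ty nqt]] : exists t, [/\ seg p y t, y <> t & ~ seg p q t].
  by apply: not_le_separated => pqy; apply: yq; exact: (@seg_antisym p).
have visit n : exists2 i, (n <= i)%N & seg p (z i) t.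
  have [|i ni [zit _]] := acc_open n (@above_open p t) _ zy; first by split.
  by exists i.
have ptq : seg p t q by have [//|/nqt] := seg_total py pyt.
have qt : q <> t by move=> qt; apply: nqt; rewrite qt; exact: segr.
have [wnq|] := pselect (forall i, w i <> q).
  have [k nk] : exists k, ~ seg p (w k) t.
    by apply: contrapT => H; apply: nqt; apply: qmax => i; apply: contrapT => ni; apply: H; exists i.
  have [i ki zit] := visit k; have [j ij zjt] := visit i.+1.
  have nw (m : nat) : (i <= m)%N -> ~ seg p (w m) t.
    move=> im wmt; apply: nk; apply: seg_trans wmt _; apply: w_anti.
    exact: leq_trans im.
  have wt (m : nat) : (i <= m)%N -> seg p t (w m).
    move=> im; apply: (seg_trans (w_anti im)).
    have [ziw _ _] := wP i.
    by have [//|/(nw _ (leqnn i))] := seg_total ziw zit.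
  have strict (m : nat) : w m.+1 <> w m.
    move=> E; apply: (wnq m); have C (a : nat) : w (m + a)%N = w m.
      elim: a => [|a IH]; first by rewrite addn0.
      by rewrite addnS -[RHS]E; exact: (congr1 g IH).
    apply: (@seg_antisym p); last exact: qw.
    apply: qmax => a; have [am|ma] := leqP a m; first exact: w_anti.
    by rewrite -(subnKC (ltnW ma)) C; exact: segr.
  (* From time [i] on, a common lower bound of [t] and [z m.+1] is below [w m]. Otherwise [w m]
     would be below two consecutive orbit points, hence below their meet [w m.+1], against strict
     descent. So the orbit cannot return above [t]. *)
  have claim (m : nat) s : (i <= m)%N -> seg p (z m.+1) s -> seg p t s -> seg p (w m) s.
    move=> im; elim: m im s => [|m IH].
      rewrite leqn0 => /eqP i0 s zs ts; apply: (is_meet_max (wP 0)) => //.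
      by rewrite -i0; exact: seg_trans ts zit.
    rewrite leq_eqVlt => /predU1P[im|im] s zs ts.
      by apply: (is_meet_max (wP m.+1)) => //; rewrite -im; exact: seg_trans ts zit.
    have [wms|sw] := seg_total ts (wt m im).
      apply: (is_meet_max (wP m.+1)) => //; have [_ zw _] := wP m.
      exact: seg_trans wms zw.
    exfalso; apply: (strict m); apply: (@seg_antisym p); first exact: w_decr.
    apply: (is_meet_max (wP m.+1)); first by case: (wP m).
    exact: seg_trans sw zs.
  case: j ij zjt => // j ij zjt.
  by apply: (nw j) => //; apply: claim => //; exact: segr.
(* From now on [w] reaches [q]: [w b <> q] and [w b.+1 = q]. As [g q = q], a pair
   of points separated by [q] has no preimage pair lying in a common component
   of the complement of [q]; hence the components containing [z i] for [i > b]
   are pairwise distinct, and [z] converges to [q]. *)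
move=> /existsNP[i0 /contrapT wi0].
pose apart i j := seg (z i) (z j) q.
have back i j : apart i j -> apart i.+1 j.+1.
  by move=> zq; rewrite /apart -gq; exact: (monotone_seg mg zq).
have apart_sym i j : apart i j -> apart j i by rewrite /apart segC.
have [b [wb wb1]] : exists b : nat, w b <> q /\ w b.+1 = q.
  elim: i0 wi0 => [w0q|i IH wi]; last first.
    by have [/IH//|wiq] := pselect (w i = q); exists i.
  by exfalso; apply: nw0; have := qw 1%N; rewrite -w0q.
have nab : ~ apart b b.+1.
  by move=> ab; apply: wb; apply: is_meet_unique (wP b) _; split.
have ab1 : apart b.+1 b.+2 by have [_ _] := wP b.+1; rewrite wb1.
(* Splitting at [z b], which [q] does not separate from [z b.+1], transfers the separation to [z b];
   applying [g] then advances both indices. *)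
have never (c : nat) : apart b.+1 (b.+2 + c)%N.
  elim: c => [|c IH]; first by rewrite addn0.
  rewrite addnS; apply: back; have [//|] := seg_split (z b) IH.
    by move=> /apart_sym /nab.
  by [].
have [i bi zit] := visit b.+1; have [j ij zjt] := visit i.+1.
have aij : apart i j.
  have Ej : j = (b.+2 + (j - i.+1) + (i - b.+1))%N by lia.
  have Ei : i = (b.+1 + (i - b.+1))%N by lia.
  rewrite Ei [in X in apart _ X]Ej; elim: (i - b.+1)%N => [|a IH]; first by rewrite !addn0.
  by rewrite !addnS; exact: back.
have no k : seg p (z k) t -> ~ seg (z k) t q.
  move=> zkt zkq; apply: qt; apply: (@seg_antisym (z k)) => //.
  by rewrite segC; exact: seg_between ptq zkt.
have [/(no _ zit)//|tq] := seg_split t aij.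
by rewrite segC in tq; exact: no zjt tq.
Qed.

End MonotoneOrbit.

(** Zorn's lemma on the subtype: a chain is bounded by a cluster point of its tails, since the sets
    of points above a given point are closed. *)
Lemma compact_maximal c A : compact A -> A !=set0 ->
  exists2 m, A m & forall y, A y -> seg c y m -> y = m.
Proof.
move=> cA [a Aa].
pose r (s s' : {x | A x}) := `[< seg c (sval s') (sval s) >].
have [||s s' sR s'R|B totB|m mmax] := @Zorn _ r.
- by move=> s; apply/asboolP; exact: segr.
- move=> s1 s2 s3 /asboolP s12 /asboolP s23; apply/asboolP.
  exact: seg_trans s12 s23.
- move: sR s'R => /asboolP + /asboolP; case: s s' => s As [s' As'] /= sR s'R.
  have E : s = s' by exact: seg_antisym sR s'R.
  by subst s'; rewrite (Prop_irrelevance As As').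
- have [[b Bb]|B0] := pselect (B !=set0); last first.
    by exists (exist _ a Aa) => s Bs; exfalso; apply: B0; exists s.
  pose F := filter_from B (fun s => A `&` [set z | seg c z (sval s)]).
  have FF : ProperFilter F.
    apply: filter_from_proper; last first.
      by move=> s _; exists (sval s); split; [exact: (svalP s)|exact: segr].
    apply: filter_from_filter; first by exists b.
    move=> s s' Bs Bs'; have [/asboolP ss'|/asboolP s's] := totB _ _ Bs Bs'.
      by exists s' => // z [Az zs']; split; split=> //; exact: seg_trans ss' zs'.
    by exists s => // z [Az zs']; split; split=> //; exact: seg_trans s's zs'.
  have [u [Au uF]] : A `&` cluster F !=set0.
    by apply: cA; exists b => // z [].
  exists (exist _ u Au) => s Bs; apply/asboolP; apply: (above_closed (a := c) (p := sval s)).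
  move=> U Unbhs.
  have Fs : F (A `&` [set z | seg c z (sval s)]) by exists s.
  have [z [[Az zs] Uz]] := uF _ _ Fs Unbhs.
  by exists z.
exists (sval m); first exact: (svalP m).
by move=> y Ay ym; have /(congr1 sval) := mmax (exist _ y Ay) (introT (asboolP _) ym).
Qed.

Section FixedPoint.
Variable g : X -> X.
Hypothesis cg : continuous g.

Lemma below_image_closed c : closed [set z | seg c (g z) z].
Proof.
rewrite -openC; apply: open_mdist => z /= nz.
have [e e0 eP] := open_mdistP (closed_openC (seg_closed dX c (g z))) nz.
have e20 : 0 < e / 2 by rewrite divr_gt0.
have [d d0 dP] := seg_small e20.
have [d' d'0 d'P] := continuous_mdist z cg d0.
exists (Num.min d' (e / 2)); first by rewrite lt_min d'0.
move=> z'; rewrite lt_min => /andP[zd' ze] /(seg_split (g z))[cz'|gz'].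
  by apply: eP cz'; apply: lt_trans ze _; rewrite gtr_pMr// invf_lt1// ltr1n.
apply: (eP (g z)); last exact: segr.
apply: le_lt_trans (metric_triangle z z' (g z)) _; rewrite [ltRHS]splitr ltrD//.
by rewrite metric_sym; apply: dP gz'; exact: d'P.
Qed.

(** Root the order at [c] and take [z] maximal in [H] with [z <= g z]. If [g z <> z], choose [t]
    strictly between them. By continuity a point [z'] slightly beyond [z] towards [t] still has
    [t <= g z'], hence [z' <= g z'], against maximality. *)
Lemma subdendrite_fixed_point H c : closed H -> connected H -> H c ->
  (forall z, H z -> H (g z)) -> exists2 z, H z & g z = z.
Proof.
move=> clH cH Hc gH.
have [||z [Hz zgz] zmax] := @compact_maximal c (H `&` [set z | seg c (g z) z]).
- apply: (@subclosed_compact _ _ [set: X]) => //; last exact: dendrite_setT_compact.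
  by apply: closedI => //; exact: below_image_closed.
- by exists c; split=> //; exact: segl.
exists z => //; apply: contrapT => gz.
have zg : z <> g z by move=> zg; exact: gz.
have [t [zgt tz tg _]] := seg_dense zg (@ltr01 R).
have tgz : seg c (g z) t by exact: (seg_sub zgz (segr c (g z)) zgt).
have [r r0 rP] : exists2 r : R, 0 < r & forall y, mdist z y < r ->
    seg c (g y) t /\ g y <> t.
  have [r r0 rP] := open_mdistP (above_open c t) (conj tgz (not_eq_sym tg)).
  by have [d d0 dP] := continuous_mdist z cg r0; exists d => // y /dP /rP.
have [z' [ztz' z'z _ zz']] := seg_dense (not_eq_sym tz) r0.
have ctz : seg c t z.
  have [czt|//] := seg_total tgz zgz.
  exfalso; apply: tz; apply: (@seg_antisym (g z)); rewrite segC //.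
  exact: seg_between czt zgz.
have cz't : seg c t z' by exact: (seg_sub ctz (segr c t) ztz').
apply: z'z; apply: zmax; last first.
  have [czz'|//] := seg_total cz't ctz.
  have -> : z' = z; last exact: segr.
  apply: (@seg_antisym t); first by rewrite segC.
  by rewrite segC; exact: seg_between czz' ctz.
split.
  apply: (seg_min cH Hz (gH _ Hz)).
  by apply: (seg_sub (segl z (g z)) zgt).
by have [+ _] := rP _ zz'; exact: seg_trans cz't.
Qed.

End FixedPoint.

End DendriteOrder.

(** * Dynamics of monotone dendrite maps *)

Lemma choose_bound (P : nat -> nat -> Prop) d :
  (forall r n n', P r n -> (n <= n')%N -> P r n') ->
  (forall r, exists n, P r n) -> exists n, forall r, (r < d)%N -> P r n.
Proof.
move=> mono exP; elim: d => [|d [n IH]]; first by exists 0%N.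
have [n' Pn'] := exP d; exists (maxn n n') => r; rewrite ltnS leq_eqVlt.
case/predU1P => [->|rd]; first exact: mono Pn' (leq_maxr _ _).
exact: mono (IH _ rd) (leq_maxl _ _).
Qed.

Section MonotoneDynamics.
Context {R : realType} {X : metricType R}.
Hypothesis dX : dendrite [set: X].
Implicit Types (A C U : set X) (a b c p q x y z t w : X).
Variable f : X -> X.
Hypotheses (cf : continuous f) (mf : monotone_map f).

Lemma asymptotically_periodic_regular x l d q : (0 < d)%N ->
  (forall e : R, 0 < e -> exists n, forall i, (n <= i)%N ->
     mdist q (iter (l + i * d) f x) < e) ->
  asymptotically_regular f x.
Proof.
move=> d0 xq e e0; have e20 : 0 < e / 2 by rewrite divr_gt0.
pose P r n := forall i, (n <= i)%N ->
  mdist (iter r f q) (iter (l + i * d + r) f x) < e / 2.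
have [| |n nP] := @choose_bound P d.
- by move=> r n n' Pn nn' i n'i; apply: Pn; exact: leq_trans n'i.
- move=> r; have [s s0 sP] := continuous_mdist q (continuous_iter (k := r) cf) e20.
  have [n nP] := xq _ s0; exists n => i ni; rewrite addnC iterD.
  by apply: sP; exact: nP.
exists d, (l + n * d)%N; split=> // m k ml.
have lm : (l <= m)%N by apply: leq_trans ml; exact: leq_addr.
pose r := ((m - l) %% d)%N; pose i := ((m - l) %/ d)%N.
have mE : m = (l + i * d + r)%N by rewrite -addnA -divn_eq subnKC.
have ni : (n <= i)%N by rewrite leq_divRL // leq_subRL.
have rd : (r < d)%N by rewrite ltn_pmod.
have mkE : (m + k * d = l + (i + k) * d + r)%N by rewrite [in LHS]mE; lia.
rewrite mkE [in X in mdist X _]mE.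
apply: le_lt_trans (metric_triangle _ (iter r f q) _) _.
rewrite [ltRHS]splitr ltrD//; first by rewrite metric_sym; exact: nP.
by apply: nP => //; exact: leq_trans (leq_addr _ _).
Qed.

Lemma fixed_point_exists : exists p, f p = p.
Proof.
have [[[c _] _ _] _ _] := dX.
have [p _ fp] := subdendrite_fixed_point dX cf closedT
  (dendrite_setT_connected dX) (I : setT c) (fun _ _ => I).
by exists p.
Qed.

(* The meet of [iter l f x] and [iter (l + d) f x] increases under [iter d f]
   unless the orbit is asymptotically periodic. *)
Lemma orbit_above p x t l d k : f p = p -> ~ (exists l d q, (0 < d)%N /\
    forall e : R, 0 < e -> exists n, forall i, (n <= i)%N ->
     mdist q (iter (l + i * d) f x) < e) ->
  seg p (iter l f x) t -> seg p (iter (l + d) f x) t ->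
  seg p (iter (l + k * d) f x) t.
Proof.
move=> fp nper xl xld.
have [d0|d0] := posnP d; first by rewrite d0 muln0 addn0.
have gp : iter d f p = p by elim: d {xld d0} => //= d ->.
have cg := continuous_iter (k := d) cf.
have mg := monotone_map_iter mf (k := d).
have [w wP] := is_meet_exists dX p (iter l f x) (iter d f (iter l f x)).
have wle : seg p (iter d f w) w.
  apply: contrapT => nw; apply: nper.
  have [q qP] := descending_meet_cvg dX cg mg gp wP nw.
  exists l, d, q; split=> // e /qP[n nP]; exists n => i /nP.
  by rewrite -iterM -iterD addnC.
have wk j : seg p (iter j (iter d f) w) w.
  elim: j => [|j IH]; first exact: segr.
  by apply: (seg_trans dX wle); rewrite iterS -{1}gp; exact: monotone_seg.
have tw : seg p w t.
  by apply: (is_meet_max dX wP) => //; rewrite -iterD addnC.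
apply: (seg_trans dX tw); apply: (seg_trans dX (wk k)).
have gkp j : iter j (iter d f) p = p by elim: j => //= j ->.
rewrite -(gkp k) addnC iterD iterM.
by apply: (monotone_seg dX (monotone_map_iter mg (k := k))); case: wP.
Qed.

Lemma monotone_asymptotically_regular x : asymptotically_regular f x.
Proof.
have [[l [d [q [d0 xq]]]]|nper] := pselect (exists l d q, (0 < d)%N /\
    forall e : R, 0 < e -> exists n, forall i, (n <= i)%N ->
     mdist q (iter (l + i * d) f x) < e).
  exact: asymptotically_periodic_regular xq.
have [p fp] := fixed_point_exists.
have prog t : exists N M, (0 < N)%N /\ forall l k, (M <= l)%N ->
    seg p (iter l f x) t <-> seg p (iter (l + k * N) f x) t.
  apply: (@eventually_progression (fun l => seg p (iter l f x) t)) => l d k.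
  exact: orbit_above.
(* By compactness finitely many thresholds [t] separate all pairs of points at
   distance at least [e]. *)
move=> e e0.
(* The factorial is a multiple of every period at most [n], so one [n] can serve all thresholds.
   Near a pair separated by [t], the progression of times above [t] makes [P n] hold vacuously. *)
pose P n (yz : X * X) := forall l k, (n <= l)%N -> yz.1 = iter l f x ->
  yz.2 = iter (l + k * n`!) f x -> mdist yz.1 yz.2 < e.
have cXX : compact [set: X * X].
  by rewrite -setXTT; apply: compact_setX; exact: dendrite_setT_compact.
have : \forall n \near \oo, [set: X * X] `<=` P n.
  move: cXX => /compact_near_coveringP; apply => -[y z] _.
  have [yze|yze] := ltP (mdist y z) e.
    pose r := (e - mdist y z) / 2; have r0 : 0 < r by rewrite divr_gt0 ?subr_gt0.
    exists ([set yz | mdist y yz.1 < r /\ mdist z yz.2 < r], setT) => /=.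
      split; last exact: filterT.
      by exists ([set u | mdist y u < r], [set u | mdist z u < r]) => //=; split; exact: mdist_nbhs.
    move=> [[y' z'] n] /= [[yy' zz'] _] l k _ _ _.
    apply: le_lt_trans (metric_triangle y' y z') _.
    have -> : e = r + (mdist y z + r).
      by rewrite addrCA -splitr addrC subrK.
    rewrite ltrD//; first by rewrite metric_sym.
    by apply: le_lt_trans (metric_triangle y z z') _; rewrite ltrD2l.
  have yz : y <> z.
    by move=> yz; move: yze; rewrite yz mdistxx leNgt e0.
  have [[t [pyt yt nzt]]|[t [pzt zt nyt]]] :
      (exists t, [/\ seg p y t, y <> t & ~ seg p z t]) \/
      (exists t, [/\ seg p z t, z <> t & ~ seg p y t]).
    have [nzy|zy] := pselect (~ seg p z y).
      by left; exact: not_le_separated dX _ _ _ nzy.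
    right; apply: not_le_separated dX _ _ _ _ => yz'; apply: yz.
    by apply: (seg_antisym dX _ yz'); exact: contrapT.
  - have [N [M [N0 NM]]] := prog t.
    exists ([set yz | (seg p yz.1 t /\ yz.1 <> t) /\ ~ seg p yz.2 t],
      [set n | (maxn N M <= n)%N]) => /=.
      split; last by exists (maxn N M).
      exists ([set u | seg p u t /\ u <> t], [set u | ~ seg p u t]) => //=.
      split; apply: open_nbhs_nbhs; split=> //; [exact: above_open|exact: avoid_open].
    move=> [[y' z'] n] /= [[[yt' _] nzt']]; rewrite geq_max => /andP[Nn Mn] l k nl /= yE zE.
    exfalso; apply: nzt'; rewrite zE.
    have /dvdnP[c ->] : (N %| n`!)%N by rewrite dvdn_fact // N0.
    rewrite mulnA; apply/(NM l) => //; first exact: leq_trans nl.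
    by rewrite -yE.
  - have [N [M [N0 NM]]] := prog t.
    exists ([set yz | ~ seg p yz.1 t /\ (seg p yz.2 t /\ yz.2 <> t)],
      [set n | (maxn N M <= n)%N]) => /=.
      split; last by exists (maxn N M).
      exists ([set u | ~ seg p u t], [set u | seg p u t /\ u <> t]) => //=.
      split; apply: open_nbhs_nbhs; split=> //; [exact: avoid_open|exact: above_open].
    move=> [[y' z'] n] /= [[nyt' [zt' _]]]; rewrite geq_max => /andP[Nn Mn] l k nl /= yE zE.
    exfalso; apply: nyt'; rewrite yE.
    have /dvdnP[c cE] : (N %| n`!)%N by rewrite dvdn_fact // N0.
    rewrite zE cE mulnA in zt'; apply/(NM l) => //; first exact: leq_trans nl.
    exact: zt'.
move=> [n _ nP]; exists n`!, n; split; first exact: fact_gt0.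
by move=> m k nm; exact: (nP n (leqnn n) (_, _) I m k nm).
Qed.

End MonotoneDynamics.

(** * Limits of periodic points and periodic points near recurrent ones *)

Section PeriodicApproximation.
Context {R : realType} {X : metricType R}.
Hypothesis dX : dendrite [set: X].
Implicit Types (A C U : set X) (a b c p q x y z t w : X).
Variable f : X -> X.
Hypotheses (cf : continuous f) (mf : monotone_map f).

Definition periodic x := exists2 N, (0 < N)%N & iter N f x = x.

Lemma iter_periodic N k x : iter N f x = x -> iter (k * N) f x = x.
Proof. by move=> fx; elim: k => // k IH; rewrite mulSn iterD IH. Qed.

Lemma periodic_factorial x : periodic x ->
  exists N, forall n, (N <= n)%N -> iter n`! f x = x.
Proof.
move=> [N N0 Nx]; exists N => n Nn.
have /dvdnP[k ->] : (N %| n`!)%N by rewrite dvdn_fact // N0.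
exact: iter_periodic.
Qed.

(** Comparability propagates along the orbit, giving a monotone sequence that returns to [c]. *)
Lemma periodic_le_fixed (h : X -> X) p c n : monotone_map h -> h p = p ->
  (0 < n)%N -> iter n h c = c -> seg p (h c) c \/ seg p c (h c) -> h c = c.
Proof.
move=> mh hp n0 hc.
have hk k a b : seg p a b -> seg p (iter k h a) (iter k h b).
  by move=> ab; elim: k => //= k IH; rewrite -{1}hp; exact: monotone_seg.
case: n n0 hc => // n _ hc [] H; apply: (@seg_antisym _ _ dX p) => //.
- suff : seg p (iter n.+1 h c) (h c) by rewrite hc.
  elim: n {hc} => [|n IH]; first exact: segr.
  by apply: (seg_trans dX IH); have := hk n.+1 _ _ H; rewrite -iterSr.
- suff : seg p (h c) (iter n.+1 h c) by rewrite hc.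
  elim: n {hc} => [|n IH]; first exact: segr.
  by apply: (seg_trans dX _ IH); have := hk n.+1 _ _ H; rewrite -iterSr.
Qed.

Definition periodic_limit y :=
  forall e : R, 0 < e -> exists2 p, periodic p & mdist y p < e.

Lemma periodic_limit_factorial y q : periodic_limit y ->
  acc (fun n => iter n`! f y) q -> q = y.
Proof.
move=> yP uq; apply: contrapT => qy.
have yP' (e : R) : 0 < e -> exists p, [/\ periodic p, mdist y p < e &
    forall z, seg y p z -> mdist y z < e].
  move=> e0; have [d d0 dP] := seg_small dX e0.
  have m0 : 0 < Num.min d e by rewrite lt_min d0.
  have [p pP] := yP _ m0; rewrite lt_min => /andP[pd pe].
  by exists p; split=> // z; exact: dP.
have [p0 fp0] := fixed_point_exists dX cf.
have ifp k : iter k f p0 = p0 by elim: k => //= k ->.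
have mk k := monotone_map_iter mf (k := k).
have lek k a b : seg p0 a b -> seg p0 (iter k f a) (iter k f b).
  by move=> ab; rewrite -{1}(ifp k); exact: (monotone_seg dX (mk k) ab).
have meetk k a b m : is_meet p0 a b m ->
    is_meet p0 (iter k f a) (iter k f b) (iter k f m).
  by move=> mP; apply: monotone_is_meet.
have meet_per a b m : periodic a -> periodic b -> is_meet p0 a b m ->
    exists N, forall n, (N <= n)%N -> iter n`! f m = m.
  move=> /periodic_factorial[N NP] /periodic_factorial[N' NP'] mP.
  exists (maxn N N') => n; rewrite geq_max => /andP[Nn Nn'].
  by have := meetk n`! _ _ _ mP; rewrite NP // NP' // => /(is_meet_unique dX); apply.
have [qley|nqley] := pselect (seg p0 q y).
  have nyq : ~ seg p0 y q.
    by move=> yq; apply: qy; exact: (seg_antisym dX yq qley).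
  have [t [qt nqt nyt]] := not_le_separated dX nyq.
  have yt : seg p0 t y by have [//|/nyt] := seg_total dX qley qt.
  have [n _ [unt untn]] := acc_open 0%N (above_open dX p0 t) (conj qt nqt) uq.
  pose g := iter n`! f.
  have [r r0 rP] := open_mdistP (above_open dX p0 t) (conj unt untn).
  have [r1 r10 r1P] := continuous_mdist y (continuous_iter (k := n`!) cf) r0.
  have [r2 r20 r2P] := open_mdistP (avoid_open dX p0 t) nyt.
  have m0 : 0 < Num.min r1 r2 by rewrite lt_min r10.
  have [p [[N N0 pN]]] := yP' _ m0.
  rewrite lt_min => /andP[_ pr2] pseg.
  have [u uP] := is_meet_exists dX p0 y p; have [yu pu ypu] := uP.
  have ut : seg p0 t u by exact: (seg_trans dX yu yt).
  have gut : seg p0 (g u) t.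
    have := pseg _ ypu; rewrite lt_min => /andP[/r1P/rP[]//].
  have gk k : seg p0 (iter k.+1 g u) t.
    elim: k => // k IH; apply: (seg_trans dX gut).
    by have := lek n`! _ _ (seg_trans dX ut IH).
  have ptle : seg p0 p t.
    have Ep : iter N g p = p by rewrite /g -iterM mulnC iter_periodic.
    have : seg p0 (iter N g p) (iter N g u) by rewrite /g -!iterM; exact: lek.
    by rewrite Ep => /(seg_trans dX _); apply; case: (N) N0 => // k _; exact: gk.
  by have := r2P p pr2.
have [t [yt nyt nqt]] := not_le_separated dX nqley.
have [r r0 rP] := open_mdistP (above_open dX p0 t) (conj yt nyt).
have often n : exists2 i, (n <= i)%N & ~ seg p0 (iter i`! f y) t.
  exact: (acc_open n (avoid_open dX p0 t) nqt uq).
have above_t p : mdist y p < r -> seg p0 p t by move=> /rP[].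
(* Such a meet is above [t] and is fixed by all late factorial iterates; if it were below [y], those
   iterates of [y] would be above [t]. *)
have meet_nle a b m : periodic a -> periodic b -> mdist y a < r ->
    mdist y b < r -> is_meet p0 a b m -> ~ seg p0 y m.
  move=> pa pb ya yb mP ym; have [N NP] := meet_per _ _ _ pa pb mP.
  have [n Nn] := often N; apply; apply: (seg_trans dX _ (lek n`! _ _ ym)).
  by rewrite NP //; apply: (is_meet_max dX mP); exact: above_t.
have meet_le a b u : periodic a -> periodic b -> mdist y a < r ->
    mdist y b < r -> is_meet p0 y a u -> seg p0 b u.
  move=> pa pb ya yb [yu au _].
  have [m mP] := is_meet_exists dX p0 a b; have [am bm _] := mP.
  have [mu|um] := seg_total dX au am; last first.
    by exfalso; apply: (meet_nle _ _ _ pa pb ya yb mP); exact: (seg_trans dX um yu).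
  exact: (seg_trans dX mu bm).
(* Let [u] be the meet of [y] with [a], and [v] that with a periodic [b] closer to [y] than [u] is.
   By [meet_le] each is below the other, so [u = v], but [v] is closer to [y]. *)
have y_le a : periodic a -> mdist y a < r -> seg p0 a y.
  move=> pa ya; have [u uP] := is_meet_exists dX p0 y a; have [yu au _] := uP.
  have [<-//|uy] := pselect (u = y).
  have m0 : 0 < Num.min r (mdist y u).
    by rewrite lt_min r0 mdist_gt0; apply/eqP => yu'; apply: uy.
  have [b [pb]] := yP' _ m0; rewrite lt_min => /andP[yb _] bseg.
  have [v vP] := is_meet_exists dX p0 y b; have [yv bv ybv] := vP.
  suff uv : u = v by have := bseg _ ybv; rewrite uv lt_min ltxx andbF.
  apply: (@seg_antisym _ _ dX p0).
    by apply: (is_meet_max dX vP) => //; exact: meet_le uP.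
  by apply: (is_meet_max dX uP) => //; exact: meet_le vP.
have [a [pa ya _]] := yP' _ r0; have [N N0 aN] := pa.
pose h := iter N f.
suff hy : h y = y.
  have [M MP] : exists M, forall n, (M <= n)%N -> iter n`! f y = y.
    by apply: periodic_factorial; exists N.
  apply: qy; apply: mdist_positivity; apply/eqP; rewrite eq_le mdist_ge0 andbT.
  apply/ler_addgt0Pr => e e0; rewrite add0r.
  by have [i Mi] := uq _ M e0; rewrite MP // => /ltW.
apply: contrapT => hy.
have e0 : 0 < mdist (h y) y / 2 by rewrite divr_gt0 // mdist_gt0; apply/eqP.
have [d d0 dP] := continuous_mdist y (continuous_iter (k := N) cf) e0.
have m0 : 0 < Num.min r (Num.min d (mdist (h y) y / 2)) by rewrite !lt_min r0 d0.
have [b [pb]] := yP' _ m0; rewrite lt_min => /andP[yb _] bseg.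
(* The meet [c] lies between [y] and [b], so it is near [y]. It is periodic, and comparable with
   [h c] since both are below [a = h a]; hence [h] fixes [c] and moves [y] by less than
   [mdist (h y) y]. *)
have [c cP] := is_meet_exists dX p0 a b; have [ac bc _] := cP.
have cy : seg p0 c y by apply: (is_meet_max dX cP); exact: y_le.
have : seg y b c by exact: (seg_between dX cy bc).
move=> /bseg; rewrite !lt_min => /and3P[_ /dP hyc yc].
have hc : h c = c.
  have [M MP] := meet_per _ _ _ pa pb cP.
  have [k kE] : exists k, ((maxn N M)`! = k * N)%N.
    by apply/dvdnP; rewrite dvdn_fact // N0 leq_maxl.
  apply: (@periodic_le_fixed h p0 c k) => //.
  - exact: mk.
  - exact: ifp.
  - by have := fact_gt0 (maxn N M); rewrite kE muln_gt0 => /andP[].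
  - by rewrite /h -iterM -kE MP // leq_maxr.
  - apply: (seg_total dX ac); rewrite -{1}aN; exact: lek.
have := metric_triangle (h y) c y; rewrite leNgt => /negP; apply.
rewrite [ltRHS]splitr ltrD //; last by rewrite metric_sym.
by rewrite -{1}hc.
Qed.

(** For large [n], [n!] is both a time at which the orbit is near [y], beyond [M], and a multiple of
    [N]. *)
Lemma periodic_limit_regularly_recurrent y : periodic_limit y ->
  forall e : R, 0 < e -> exists2 N, (0 < N)%N &
    forall k, mdist y (iter (k * N) f y) < e.
Proof.
move=> yP e e0; have e20 : 0 < e / 2 by rewrite divr_gt0.
have [N [M [N0 NM]]] := monotone_asymptotically_regular dX cf mf y e20.
have [q uq] := acc_exists (fun n => iter n`! f y) (dendrite_setT_compact dX).
have qy := periodic_limit_factorial yP uq; rewrite qy in uq.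
have [n nNM yn] := uq _ (maxn N M) e20.
move: nNM; rewrite geq_max => /andP[Nn Mn].
exists n`!; first exact: fact_gt0.
case=> [|k]; first by rewrite mdistxx.
have /dvdnP[c cE] : (N %| n`!)%N by rewrite dvdn_fact // N0.
rewrite mulSn {2}cE mulnA; apply: le_lt_trans (metric_triangle _ (iter n`! f y) _) _.
rewrite [ltRHS]splitr ltrD //; apply: NM.
by apply: leq_trans Mn _; exact: fact_geq.
Qed.

(** The union of the segments from [c] to the [iter k g c] is connected and within [e] of [c]. It is
    mapped into itself, because a segment from [g c] is covered by two segments from [c]. The fixed
    point is found in its closure, whence the weak inequality. *)
Lemma nearly_periodic_point (e : R) : 0 < e -> exists2 d : R, 0 < d &
  forall c N, (0 < N)%N -> (forall k, mdist c (iter (k * N) f c) < d) ->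
  exists2 p, periodic p & mdist c p <= e.
Proof.
move=> e0; have [d d0 dP] := seg_small dX e0; exists d => // c N N0 cN.
pose g := iter N f; pose U := \bigcup_(k in [set: nat]) seg c (iter k g c).
have cU : connected U.
  apply: bigcup_connected; first by exists c => k _; exact: segl.
  by move=> k _; exact: (seg_connected dX).
have Uc : U c by exists 0%N => //; exact: segl.
have cg : continuous g := continuous_iter (k := N) cf.
have gU : U `<=` g @^-1` U.
  move=> z [k _ /(monotone_seg dX (monotone_map_iter mf (k := N))) /=].
  rewrite -/g => /(seg_split dX c) [z1|zk].
    by exists 1%N => //; rewrite segC.
  by exists k.+1.
have [||||p Hp gp] := @subdendrite_fixed_point _ _ dX g cg (closure U) c.
- exact: closed_closure.
- exact: connected_closure.
- exact: subset_closure.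
- move=> z; have cpre : closed (g @^-1` closure U).
    by apply: closed_comp => [? _|]; [exact: cg|exact: closed_closure].
  suff : closure U `<=` g @^-1` closure U by apply.
  rewrite [X in _ `<=` X](closure_id _).1 //; apply: closureS => y /gU.
  exact: (@subset_closure _ U (g y)).
exists p; first by exists N.
apply/ler_addgt0Pr => r r0; have [y [[k _ cy] py]] := Hp _ (mdist_nbhs p r0).
apply: (le_trans (metric_triangle c y p)); rewrite lerD //.
  by apply/ltW; apply: dP cy; rewrite /g -iterM.
by apply/ltW; rewrite metric_sym.
Qed.

End PeriodicApproximation.

(** * Trees as hulls of finitely many points *)

Section Hulls.
Context {R : realType} {X : metricType R}.
Hypothesis dX : dendrite [set: X].
Implicit Types (A C U : set X) (p q x y z t w : X).

(** One ultrafilter makes all coordinates converge at once, in place of successive extraction of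
    subsequences. *)
Lemma tuple_accumulation n (u : nat -> 'I_n -> X) : exists b : 'I_n -> X,
  forall (e : R) m, 0 < e ->
    exists2 j, (m <= j)%N & forall i, mdist (b i) (u j i) < e.
Proof.
have cX := dendrite_setT_compact dX; have [G [GU ooG]] := ultraFilterLemma eventually_filter.
have lim i : exists b, forall e : R, 0 < e -> G [set j | mdist b (u j i) < e].
  have [b [_ bG]] := cX (u^~ i @ G) _ filterT.
  exists b => e e0; have [//|nG] := in_ultra_setVsetC [set j | mdist b (u j i) < e] GU.
  exfalso; have [|z [nz zb]] := bG [set z | ~ mdist b z < e] _ _ (mdist_nbhs b e0).
    exact: nG.
  exact: nz.
have [b bP] := choice lim; exists b => e m e0.
have Gm : G [set j | (m <= j)%N] by apply: ooG; exists m.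
have Gb : G [set j | forall i, mdist (b i) (u j i) < e].
  by apply: filter_forall => i; exact: bP.
by have [j [mj bj]] := filter_ex (filterI Gm Gb); exists j.
Qed.

(** Pairwise segments already form a connected set, hence the least one containing the points.
    Repeated entries are allowed, so [n] only bounds the number of endpoints. *)
Definition hull n (a : 'I_n -> X) : set X :=
  [set z | exists i j, seg (a i) (a j) z].

Variable n : nat.
Hypothesis n0 : (0 < n)%N.
Implicit Types a b : 'I_n -> X.

Lemma hull_mem a i : hull a (a i).
Proof. by exists i, i; exact: segl. Qed.

Lemma hull_neq0 a : hull a !=set0.
Proof. by exists (a (Ordinal n0)); exact: hull_mem. Qed.

Lemma hull_closed a : closed (hull a).
Proof.
rewrite (_ : hull a = \bigcup_(ij in [set: 'I_n * 'I_n]) seg (a ij.1) (a ij.2)).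
  apply: closed_bigcup; first exact: finite_finset.
  by move=> i _; exact: (seg_closed dX).
apply/seteqP; split=> [z [i [j zij]]|z [[i j] _ zij]]; last by exists i, j.
by exists (i, j).
Qed.

Lemma hull_connected a : connected (hull a).
Proof.
pose o := Ordinal n0.
rewrite (_ : hull a = \bigcup_(ij in [set: 'I_n * 'I_n])
    (seg (a o) (a ij.1) `|` seg (a ij.1) (a ij.2))).
  apply: bigcup_connected; first by exists (a o) => ij _; left; exact: segl.
  move=> ij _; apply: connectedU; [|exact: (seg_connected dX)|exact: (seg_connected dX)].
  by exists (a ij.1); split; [exact: segr|exact: segl].
apply/seteqP; split=> [z [i [j zij]]|z [[i j] _ [zi|zij]]]; [|by exists o, i|by exists i, j].
by exists (i, j) => //; right.
Qed.

Lemma hull_min a C : connected C -> (forall i, C (a i)) -> hull a `<=` C.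
Proof. by move=> cC Ca z [i [j]]; exact: seg_min. Qed.

Lemma hull_image (f : X -> X) a : continuous f -> monotone_map f ->
  f @` hull a = hull (f \o a).
Proof.
move=> cf mf; apply/seteqP; split=> [_ [z [i [j zij]] <-]|].
  by exists i, j; exact: (monotone_seg dX mf zij).
apply: hull_min => [|i]; last by exists (a i) => //; exact: hull_mem.
apply: connected_continuous_connected; first exact: hull_connected.
exact: continuous_subspaceT.
Qed.

(** Both sets contain the segment between any two common points. This makes local connectedness pass
    to subcontinua. *)
Lemma connected_setI A C : connected A -> connected C -> connected (A `&` C).
Proof.
move=> cA cC; have [[x [Ax Cx]]|AC0] := pselect (A `&` C !=set0); last first.
  rewrite (_ : A `&` C = set0); first exact: connected0.
  by apply/seteqP; split=> // x ACx; apply: AC0; exists x.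
rewrite (_ : A `&` C = \bigcup_(y in A `&` C) seg x y).
  by apply: bigcup_connected => [|y _]; [exists x => y _; exact: segl|exact: (seg_connected dX)].
apply/seteqP; split=> [y ACy|z [y [Ay Cy] xyz]]; first by exists y => //; exact: segr.
by split; [exact: seg_min xyz|exact: seg_min xyz].
Qed.

Lemma subcontinuum_dendrite A : continuum A -> dendrite A.
Proof.
move=> contA; split=> //.
- move=> x U Ax oU Ux; have [V [oV Vx cV VU]] := connected_nbhs dX (open_nbhs_nbhs (conj oU Ux)).
  exists V; split=> //; last by move=> y [_ /VU].
  by apply: connected_setI => //; case: contA.
- by case: dX => _ _ nS [S SC SA]; apply: nS; exists S.
Qed.

Lemma hull_continuum a : continuum (hull a).
Proof.
split; [exact: hull_neq0| |exact: hull_connected].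
by apply: (@subclosed_compact _ _ [set: X]) => //; [exact: hull_closed|exact: dendrite_setT_compact].
Qed.

Lemma hull_endpoint a : endpoint (hull a) `<=` range a.
Proof.
move=> p [hp [hE|[_ cE]]]; first by exists (Ordinal n0) => //; have := hull_mem a (Ordinal n0); rewrite hE.
apply: contrapT => np; have ap i : (hull a `\ p) (a i).
  by split; [exact: hull_mem|move=> /= E; apply: np; exists i].
by have [_] := hull_min cE ap hp; apply.
Qed.

Lemma hull_card a : (endpoint (hull a) #<= `I_n)%card.
Proof.
apply: card_le_trans (subset_card_le (@hull_endpoint a)) _.
pose h k := a (insubd (Ordinal n0) k).
apply: card_le_trans (card_image_le h `I_n); apply: subset_card_le.
by move=> _ [i _ <-]; exists (val i); rewrite /= ?ltn_ord // /h valKd.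
Qed.

(** Take [e] maximal above [x] in [T]. Nothing in [T] lies beyond [e], so the rest of [T] is a union
    of segments from [c] avoiding [e]. The case [e = c] is the one-point convention. *)
Lemma continuum_endpoint T c : continuum T -> T c ->
  forall x, T x -> exists2 e, endpoint T e & seg c e x.
Proof.
move=> [_ cT conT] Tc x Tx.
have [||e [Te xe] emax] := @compact_maximal _ _ dX c (T `&` [set z | seg c z x]).
- by apply: compact_closedI => //; exact: above_closed.
- by exists x; split=> //; exact: segr.
exists e => //; split=> //.
have {}emax y : T y -> seg c y e -> y = e.
  by move=> Ty ye; apply: emax => //; split=> //; exact: (seg_trans dX xe ye).
have [ec|ec] := pselect (e = c).
  left; apply/seteqP; split=> [y Ty|_ ->//]; apply: emax => //.
  by rewrite ec; exact: segl.
right; split; first by exists c; split=> // ce; exact: ec.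
rewrite (_ : T `\ e = \bigcup_(y in T `\ e) seg c y).
  by apply: bigcup_connected => [|y _]; [exists c => y _; exact: segl|exact: (seg_connected dX)].
apply/seteqP; split=> [y Ty|z [y [Ty ye] cyz]]; first by exists y => //; exact: segr.
split; first exact: (seg_min conT Tc Ty).
by move=> /= ze; apply: ye; apply: emax => //; rewrite -ze.
Qed.

Lemma tree_hull T : continuum T -> (endpoint T #<= `I_n)%card ->
  exists a, T = hull a.
Proof.
move=> contT cardT; have [[o To] _ conT] := contT.
(* Rooting at an endpoint puts every point of [T] on a segment between two endpoints. The same [c]
   fills the indices that enumerate no endpoint. *)
have [c ec _] := continuum_endpoint contT To To.
have /pcard_leP[phi] := cardT.
pose a (i : 'I_n) := xget c [set e | endpoint T e /\ phi e = i :> nat].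
have aT i : endpoint T (a i) by rewrite /a; case: xgetP => // e _ [].
have aP e : endpoint T e -> exists i, a i = e.
  move=> Te; have lt : (phi e < n)%N by exact: (@funS _ _ _ _ phi e Te).
  exists (Ordinal lt); rewrite /a.
  case: xgetP => [e' _ [Te' /= E]|/(_ e) /=]; last by case.
  by apply: (inj (f := phi)); rewrite ?inE.
exists a; apply/seteqP; split; last by apply: hull_min => // i; case: (aT i).
move=> x Tx; have [e Te xe] := continuum_endpoint contT ec.1 Tx.
have [i iE] := aP _ ec; have [j jE] := aP _ Te.
by exists i, j; rewrite iE jE.
Qed.

(** The segment from [a i] to [a j] is covered by the one from [b i] to [b j] and two short ones
    joining [a i] to [b i] and [b j] to [a j]. *)
Lemma hull_near (e : R) : 0 < e -> exists2 d : R, 0 < d &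
  forall a b, (forall i, mdist (a i) (b i) < d) -> in_thickening e (hull a) (hull b).
Proof.
move=> e0; have [d d0 dP] := seg_small dX e0; exists d => // a b ab.
move=> z [i [j]] /(seg_split dX (b i)) [zi|/(seg_split dX (b j))[zij|zj]].
- exists (b i); first exact: hull_mem.
  by rewrite metric_sym; apply: dP; [rewrite metric_sym; exact: ab|rewrite segC; exact: zi].
- by exists z; [exists i, j|rewrite mdistxx].
- exists (b j); first exact: hull_mem.
  by rewrite metric_sym; apply: dP; [rewrite metric_sym; exact: ab|exact: zj].
Qed.

End Hulls.

(** * The induced map on trees *)

Section MinimalOmega.
Context {R : realType} {Z : metricType R}.
Variables (Y : set Z) (F : Z -> Z).
Hypotheses (cF : continuous F) (FY : forall y, Y y -> Y (F y)).
Implicit Types (y z S : Z).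

Lemma closure_mdist (A : set Z) z :
  closure A z <-> forall e : R, 0 < e -> exists2 y, A y & mdist z y < e.
Proof.
split=> [Az e /(mdist_nbhs z)/Az[y [Ay zy]]|H U /nbhs_mdist[e /H[y Ay zy] eU]].
  by exists y.
by exists y; split=> //; exact: eU.
Qed.

Lemma omega_limitP y z : omega_limit Y F y z <->
  Y z /\ acc (fun k => iter k F y) z.
Proof.
split=> [H|[Yz H] n _]; last first.
  split=> //; apply/closure_mdist => e e0; have [k nk zk] := H _ n e0.
  by exists (iter k F y) => //; exists k.
split; first by have [] := H 1%N (ltn0Sn 0).
move=> e n e0; have [_ /closure_mdist/(_ _ e0)[_ [k /= nk <-] zk]] := H n.+1 (ltn0Sn n).
by exists k => //; exact: ltnW.
Qed.

Lemma continuous_iter_upto z N (e : R) : 0 < e -> exists2 d : R, 0 < d &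
  forall r y, (r < N)%N -> mdist z y < d -> mdist (iter r F z) (iter r F y) < e.
Proof.
move=> e0; elim: N => [|N [d d0 dP]]; first by exists 1.
have [d' d'0 d'P] := continuous_mdist z (continuous_iter (k := N) cF) e0.
exists (Num.min d d'); first by rewrite lt_min d0.
move=> r y; rewrite ltnS leq_eqVlt lt_min => /predU1P[->|rN] /andP[zd zd'].
  exact: d'P.
exact: dP.
Qed.

Lemma omega_limit_closed_invariant y : omega_limit Y F y !=set0 ->
  closed_invariant Y F (omega_limit Y F y).
Proof.
move=> ne; split=> //.
  exists (\bigcap_(n in [set n | (0 < n)%N])
    closure [set iter k F y | k in [set k | (n <= k)%N]]).
    by apply: closed_bigI => n _; exact: closed_closure.
  apply/seteqP; split=> [z H|z [Yz H] n n0]; last by split=> //; exact: H.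
  by split=> [|n n0]; [have [] := H 1%N (ltn0Sn 0)|have [] := H n n0].
move=> _ [z /omega_limitP[Yz zy] <-]; apply/omega_limitP; split; first exact: FY.
move=> e m e0; have [k mk zk] := acc_continuous cF zy m e0.
by exists k.+1 => //; exact: leqW.
Qed.

Lemma omega_limit_minimal y : asymptotically_regular F y ->
  omega_limit Y F y !=set0 -> minimal_set Y F (omega_limit Y F y).
Proof.
move=> ry ne; split; first exact: omega_limit_closed_invariant.
move=> M [[m Mm] [C cC ME] FM] My; apply/seteqP; split=> // z /omega_limitP[Yz zy].
have Miter k : M (iter k F m).
  by elim: k => // k IH; apply: FM; exists (iter k F m).
rewrite ME; split=> //; rewrite (closure_id C).1 //; apply/closure_mdist => e e0.
have e30 : 0 < e / 3 by rewrite divr_gt0.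
have [N [L [N0 NL]]] := ry _ e30.
have [i Li zi] := zy _ L e30.
have [d d0 dP] := continuous_iter_upto m N e30.
have /omega_limitP[_ my] := My _ Mm.
have [l il ml] := my _ i d0.
(* The delay that makes [r + l] congruent to [i] modulo [N]. Then [iter r F m], a point of [M], is
   near [iter (i + k * N) F y], hence near [iter i F y] and [z]. As [r < N], [d] could be fixed
   before [l]. *)
pose r := ((N - (l - i) %% N) %% N)%N.
have rN : (r < N)%N by rewrite ltn_pmod.
have [k lk] : exists k, (r + l = i + k * N)%N.
  have /dvdnP[k kE] : (N %| (l - i) + r)%N.
    have mN : ((l - i) %% N <= N)%N by rewrite ltnW // ltn_pmod.
    by rewrite /dvdn modnDmr -modnDml subnKC // modnn.
  by exists k; rewrite -kE; lia.
exists (iter r F m); first by have := Miter r; rewrite ME => -[].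
apply: le_lt_trans (metric_triangle z (iter i F y) _) _.
have -> : e = e / 3 + (e / 3 + e / 3) by field.
rewrite ltrD //; apply: le_lt_trans (metric_triangle _ (iter (i + k * N) F y) _) _.
rewrite ltrD //; first exact: NL.
by rewrite -lk iterD metric_sym; exact: dP.
Qed.

Lemma omega_regularly_recurrent y z : asymptotically_regular F y ->
  omega_limit Y F y z -> regularly_recurrent Y F z.
Proof.
move=> ry /omega_limitP[Yz zy]; split=> // e e0.
have e30 : 0 < e / 3 by rewrite divr_gt0.
have [N [L [N0 NL]]] := ry _ e30; exists N => // k _.
(* The radius [d] and the time [i] depend on [k], but [N] does not. *)
have [d d0 dP] := continuous_mdist z (continuous_iter (k := k * N) cF) e30.
have m0 : 0 < Num.min d (e / 3) by rewrite lt_min d0.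
have [i Li] := zy _ L m0; rewrite lt_min => /andP[zid zie].
apply: le_lt_trans (metric_triangle z (iter i F y) _) _.
have -> : e = e / 3 + (e / 3 + e / 3) by field.
rewrite ltrD //; apply: le_lt_trans (metric_triangle _ (iter (i + k * N) F y) _) _.
rewrite ltrD //; first exact: NL.
by rewrite addnC iterD metric_sym; exact: dP.
Qed.

Lemma regularly_recurrent_Lambda : regularly_recurrent Y F `<=` Lambda Y F.
Proof.
move=> z [Yz rz]; exists z => //; apply/omega_limitP; split=> // e n e0.
have [N N0 NP] := rz _ e0; exists (n.+1 * N)%N; last exact: NP.
by apply: leq_trans (leqnSn n) _; exact: leq_pmulr.
Qed.

End MinimalOmega.

Section TreeDynamics.
Context {R : realType} {X : metricType R}.
Hypothesis dX : dendrite [set: X].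
Variable f : X -> X.
Hypotheses (cf : continuous f) (mf : monotone_map f).
Variable n : nat.
Hypothesis n0 : (0 < n)%N.
Local Notation H := (hyperspace (dendrite_compact dX)).
Let Tn := @trees R X (dendrite_compact dX) n.
Let F := hyperspace_map (cX := dendrite_compact dX) cf.
Implicit Types a b p : 'I_n -> X.

Lemma uniform_continuity (e : R) : 0 < e -> exists2 d : R, 0 < d &
  forall x y, mdist x y < d -> mdist (f x) (f y) < e.
Proof.
move=> e0; have e20 : 0 < e / 2 by rewrite divr_gt0.
apply: (lebesgue_number (dendrite_setT_compact dX)) => x.
have [r r0 rP] := continuous_mdist x cf e20; exists r => // y z /rP xy /rP xz.
by have := metric_triangle (f y) (f x) (f z); rewrite (metric_sym (f y) (f x)); lra.
Qed.

Lemma hyperspace_map_continuous : continuous F.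
Proof.
move=> A U /nbhs_mdist[e e0 eU]; have e20 : 0 < e / 2 by rewrite divr_gt0.
have [d d0 dP] := uniform_continuity e20.
apply: filterS (mdist_nbhs A d0) => B /hausdorff_radii_lt[_ AB BA].
apply: eU; apply: (@le_lt_trans _ _ (e / 2)); last by rewrite gtr_pMr// invf_lt1// ltr1n.
apply: hausdorff_dist_le; split=> //= _ [x /= Cx <-].
  by have [y By xy] := AB _ Cx; exists (f y); [exists y|exact: dP].
by have [y By xy] := BA _ Cx; exists (f y); [exists y|exact: dP].
Qed.

Definition hull_point a : H :=
  Hyperspace (dendrite_compact dX) (@hull_closed _ _ dX n a) (hull_neq0 n0 a).

Lemma hull_point_near (e : R) : 0 < e -> exists2 d : R, 0 < d &
  forall a b, (forall i, mdist (a i) (b i) < d) ->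
    mdist (hull_point a) (hull_point b) <= e.
Proof.
move=> e0; have [d d0 dP] := hull_near dX n e0; exists d => // a b ab.
apply: hausdorff_dist_le; split=> //; first exact: dP.
by apply: dP => i; rewrite metric_sym.
Qed.

Lemma hyperspace_map_hull a : F (hull_point a) = hull_point (f \o a).
Proof. by apply: hset_inj; exact: hull_image. Qed.

Lemma iter_hull k a : iter k F (hull_point a) = hull_point (iter k f \o a).
Proof.
elim: k => [|k IH] /=; first by congr hull_point; apply/funext.
by rewrite IH hyperspace_map_hull; congr hull_point; apply/funext.
Qed.

Lemma trees_hull a : Tn (hull_point a).
Proof.
have Hc := hull_card n0 a.
split=> //; split; last by apply/finite_set_leP; exists n.
by apply: (subcontinuum_dendrite dX); exact: hull_continuum.
Qed.

Lemma trees_hull_point T : Tn T -> exists a, T = hull_point a.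
Proof.
move=> [[[contT _ _] _] cT]; have [a aT] := tree_hull dX contT cT.
by exists a; apply: hset_inj.
Qed.

Lemma trees_stable T : Tn T -> Tn (F T).
Proof.
by move=> /trees_hull_point[a ->]; rewrite hyperspace_map_hull; exact: trees_hull.
Qed.

(** The product of the individual periods serves all coordinates. *)
Lemma tuple_period (P : 'I_n -> nat -> Prop) :
  (forall i N k, P i N -> P i (k * N)%N) ->
  (forall i, exists2 N, (0 < N)%N & P i N) ->
  exists2 N, (0 < N)%N & forall i, P i N.
Proof.
move=> Pmul exP; have /choice[N NP] i : exists N, (0 < N)%N /\ P i N.
  by have [N] := exP i; exists N.
exists (\prod_i N i)%N; first by apply: prodn_gt0 => i; case: (NP i).
move=> i; rewrite (bigD1 i) //= mulnC; apply: Pmul; by case: (NP i).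
Qed.

Lemma tuple_bound (P : 'I_n -> nat -> Prop) :
  (forall i, exists M, forall m, (M <= m)%N -> P i m) ->
  exists M, forall m, (M <= m)%N -> forall i, P i m.
Proof.
move=> /choice[M MP]; exists (\max_i M i)%N => m Mm i; apply: MP.
by apply: leq_trans Mm; exact: leq_bigmax.
Qed.

Lemma trees_asymptotically_regular T : Tn T -> asymptotically_regular F T.
Proof.
move=> /trees_hull_point[a ->] e e0; have e20 : 0 < e / 2 by rewrite divr_gt0.
have [d d0 dP] := hull_point_near e20.
pose P i N := exists M, forall m, (M <= m)%N -> forall k,
  mdist (iter m f (a i)) (iter (m + k * N) f (a i)) < d.
have [||N N0 NP] := @tuple_period P.
- by move=> i N c [M MP]; exists M => m Mm k; rewrite mulnA; exact: MP.
- move=> i; have [N [M [N0 NM]]] := monotone_asymptotically_regular dX cf mf (a i) d0.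
  by exists N => //; exists M => m Mm k; exact: NM.
have [M MP] := tuple_bound NP; exists N, M; split=> // m k Mm.
rewrite !iter_hull; apply: (@le_lt_trans _ _ (e / 2)).
  by apply: dP => i; exact: MP.
by rewrite gtr_pMr// invf_lt1// ltr1n.
Qed.

Lemma trees_omega_limit_neq0 T : Tn T -> omega_limit Tn F T !=set0.
Proof.
move=> /trees_hull_point[a ->].
have [b bP] := tuple_accumulation dX (fun j i => iter j f (a i)).
exists (hull_point b); apply/omega_limitP; split; first exact: trees_hull.
move=> e m e0; have e20 : 0 < e / 2 by rewrite divr_gt0.
have [d d0 dP] := hull_point_near e20; have [j mj bj] := bP _ m d0.
exists j => //; rewrite iter_hull; apply: (@le_lt_trans _ _ (e / 2)).
  by apply: dP => i; exact: bj.
by rewrite gtr_pMr// invf_lt1// ltr1n.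
Qed.

(** Late orbit points of each generator recur uniformly along multiples of some [N], which is the
    hypothesis of [nearly_periodic_point]. *)
Lemma trees_near_periodic T (e : R) : Tn T -> 0 < e -> exists M, forall m,
  (M <= m)%N -> exists2 p, (forall i, periodic f (p i)) &
    mdist (iter m F T) (hull_point p) <= e.
Proof.
move=> /trees_hull_point[a ->] e0.
have [d d0 dP] := hull_point_near e0; have d20 : 0 < d / 2 by rewrite divr_gt0.
have [r r0 rP] := nearly_periodic_point dX cf mf d20.
pose P i m := exists2 x, periodic f x & mdist (iter m f (a i)) x <= d / 2.
have [|M MP] := @tuple_bound P.
  move=> i; have [N [M [N0 NM]]] := monotone_asymptotically_regular dX cf mf (a i) r0.
  exists M => m Mm; apply: (rP _ N) => // k.
  by rewrite -iterD addnC; exact: NM.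
exists M => m Mm; have /choice[p pP] i : exists x, periodic f x /\ mdist (iter m f (a i)) x <= d / 2.
  by have [x] := MP m Mm i; exists x.
exists p; first by move=> i; case: (pP i).
rewrite iter_hull; apply: dP => i; have [_] := pP i; move=> /le_lt_trans; apply.
by rewrite gtr_pMr// invf_lt1// ltr1n.
Qed.

Lemma hull_periodic p : (forall i, periodic f (p i)) ->
  periodic_points Tn F (hull_point p).
Proof.
move=> pP; split; first exact: trees_hull.
have [|N N0 NP] := @tuple_period (fun i N => iter N f (p i) = p i) _ pP.
  by move=> i N k; exact: iter_periodic.
by exists N => //; rewrite iter_hull; congr hull_point; apply/funext.
Qed.

(** Accumulating the tuples writes [S] as the hull of points [b i], each a limit of periodic points
    and hence recurrent; a common period then works for the hull. *)
Lemma periodic_hull_limit S :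
  (forall e : R, 0 < e -> exists2 p, (forall i, periodic f (p i)) &
    mdist S (hull_point p) < e) -> regularly_recurrent Tn F S.
Proof.
move=> SP; have /choice[u uP] j : exists p, (forall i, periodic f (p i)) /\
    mdist S (hull_point p) < j.+1%:R^-1.
  by have [|p] := SP j.+1%:R^-1; rewrite ?invr_gt0 ?ltr0n // ; exists p.
have [b bP] := tuple_accumulation dX u.
have -> : S = hull_point b.
  apply: mdist_positivity; apply/eqP; rewrite eq_le mdist_ge0 andbT.
  apply/ler_addgt0Pr => e e0; rewrite add0r; have e20 : 0 < e / 2 by rewrite divr_gt0.
  have [d d0 dP] := hull_point_near e20.
  have [m] := ltr_add_invr e20; rewrite add0r => mP.
  have [j mj bj] := bP _ m d0.
  apply: le_trans (metric_triangle _ (hull_point (u j)) _) _.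
  rewrite [leRHS]splitr lerD //; last by rewrite metric_sym; exact: dP.
  have [_ /ltW/le_trans] := uP j; apply; apply: le_trans (ltW mP).
  by rewrite lef_pV2 ?posrE ?ltr0n // ler_nat.
split; first exact: trees_hull.
move=> e e0; have e20 : 0 < e / 2 by rewrite divr_gt0.
have [d d0 dP] := hull_point_near e20.
have [||N N0 NP] := @tuple_period (fun i N => forall k, mdist (b i) (iter (k * N) f (b i)) < d).
- by move=> i N c cP k; rewrite mulnA; exact: cP.
- move=> i; apply: (periodic_limit_regularly_recurrent dX cf mf) => // r r0.
  by have [j _ bj] := bP _ 0%N r0; exists (u j i) => //; case: (uP j).
exists N => // k _; rewrite iter_hull; apply: (@le_lt_trans _ _ (e / 2)).
  by apply: dP => i; exact: NP.
by rewrite gtr_pMr// invf_lt1// ltr1n.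
Qed.

Lemma trees_Lambda : Lambda Tn F = regularly_recurrent Tn F.
Proof.
apply/seteqP; split=> [S [T TnT TS]|]; last exact: regularly_recurrent_Lambda.
apply: (omega_regularly_recurrent hyperspace_map_continuous _ TS).
exact: trees_asymptotically_regular.
Qed.

Lemma trees_closure_periodic :
  closure_in Tn (periodic_points Tn F) = regularly_recurrent Tn F.
Proof.
apply/seteqP; split=> [S [TnS /closure_mdist SP]|S [TnS rS]].
  apply: periodic_hull_limit => e e0; have e20 : 0 < e / 2 by rewrite divr_gt0.
  have [T [TnT [m m0 mT]] ST] := SP _ e20.
  have [M MP] := trees_near_periodic TnT e20.
  (* A periodic tree is its own late iterate, so it is near a hull of periodic points. *)
  have [|p pP Tp] := MP (M * m)%N; first exact: leq_pmulr.
  exists p => //; rewrite (iter_periodic (f := F)) // in Tp.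
  apply: le_lt_trans (metric_triangle S T _) _.
  by rewrite [ltRHS]splitr ltr_leD.
split=> //; apply/closure_mdist => e e0; have e20 : 0 < e / 2 by rewrite divr_gt0.
have [M MP] := trees_near_periodic TnS e20.
have [N N0 NP] := rS _ e20.
have [|p pP Sp] := MP (M.+1 * N)%N.
  by apply: leq_trans (leqnSn M) _; exact: leq_pmulr.
exists (hull_point p); first exact: hull_periodic.
apply: le_lt_trans (metric_triangle S (iter (M.+1 * N) F S) _) _.
by rewrite [ltRHS]splitr ltr_leD // NP.
Qed.

End TreeDynamics.

Theorem corollary6p4 (R : realType) (X : metricType R)
    (dX : dendrite [set: X]) (f : X -> X) (cf : continuous f)
    (mf : monotone_map f) (n : nat) (hn : (0 < n)%N) :
  let Tn := @trees R X (dendrite_compact dX) n in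
  let F := hyperspace_map (cX := dendrite_compact dX) cf in
  (forall T, Tn T -> minimal_set Tn F (omega_limit Tn F T)) /\
  closure_in Tn (periodic_points Tn F) = Lambda Tn F /\
  Lambda Tn F = regularly_recurrent Tn F.
Proof.
move=> Tn F; split=> [T TnT|].
  apply: omega_limit_minimal.
  - exact: hyperspace_map_continuous.
  - by move=> S; exact: trees_stable.
  - exact: trees_asymptotically_regular TnT.
  - exact: trees_omega_limit_neq0 TnT.
by rewrite /Tn /F trees_Lambda // trees_closure_periodic.
Qed.
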